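(* Let $n\ge2$, let $\tau$ be an $n$-core partition, let $i\in\{0,\dots,n-1\}$, and let $w\ge 0$ be an integer with $w\le k_i$. Let $\pi_i:\mathcal{P}_0(\tau,w)\to\mathcal{P}_0(\sigma_i(\tau),w)$ be Scopes' bijection. Then for all $\lambda,\mu\in\mathcal{P}_0(\tau,w)$, $$d_{\lambda,\mu}(v)=d_{\pi_i(\lambda),\pi_i(\mu)}(v),\qquad e_{\lambda,\mu}(v)=e_{\pi_i(\lambda),\pi_i(\mu)}(v).$$
   Context: **Partitions and abacus.** Fix $n\ge 2$. $\mathcal{P}$ is the set of all integer partitions; Young diagrams are drawn in English convention (row 1 at the top). The cell in row $a$, column $b$ has content $b-a$; it is an $i$-node (has $n$-residue $i$) if $b-a\equiv i \bmod n$. To $\lambda$ associate its $\beta$-numbers $\lambda_k-k+1$, $k\ge1$ (with $\lambda_k=0$ for large $k$). The $n$-abacus has runners $1,\dots,n$, runner $c$ consisting of the integers $\equiv c \bmod n$; place a bead at each $\beta$-number. Sliding all beads as far as possible along their runners towards smaller integers gives the $n$-core of $\lambda$; the $n$-weight $|\lambda|_n$ satisfies $|\lambda|=|n\text{-core}|+n|\lambda|_n$. The $n$-cores are in bijection with tuples $(a_1,\dots,a_n)\in\mathbb{Z}^n$ with $\sum a_c=0$, where $a_c$ is the number of beads at positive positions on runner $c$ minus the number of vacant non-positive positions on runner $c$. **Scopes' bijection.** Let $\tau$ be the $n$-core with tuple $(a_1,\dots,a_n)$. For $1\le i\le n-1$, $\sigma_i(\tau)$ is the $n$-core whose tuple is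 obtained by exchanging $a_i$ and $a_{i+1}$; $\sigma_0(\tau)$ is the $n$-core with tuple $(a_n+1,a_2,\dots,a_{n-1},a_1-1)$. Put $k_i=a_{i+1}-a_i$ if $i\ne0$ and $k_0=a_1-a_n-1$. $\mathcal{P}_0(\tau,w)$ is the set of partitions with $n$-core $\tau$ and $n$-weight exactly $w$. When $w\le k_i$, each $\lambda\in\mathcal{P}_0(\tau,w)$ has exactly $k_i$ removable $i$-nodes, and $\pi_i(\lambda)\in\mathcal{P}_0(\sigma_i(\tau),w)$ is the partition obtained from $\lambda$ by removing them all; $\pi_i$ is a bijection $\mathcal{P}_0(\tau,w)\to\mathcal{P}_0(\sigma_i(\tau),w)$. **Fock space and canonical bases.** $K=\mathbb{C}(v)$; $\mathcal{F}_v$ is the $K$-vector space with basis $\{s(\lambda)\mid\lambda\in\mathcal{P}\}$. For $0\le i\le n-1$, $F_is(\lambda)=\sum_\mu v^{N_i^r(\lambda,\mu)}s(\mu)$, summed over $\mu$ obtained from $\lambda$ by adding an $i$-node $\gamma$, where $N_i^r(\lambda,\mu)$ is the number of addable $i$-nodes of $\lambda$ strictly to the right of $\gamma$ minus the number of removable $i$-nodes of $\lambda$ strictly to the right of $\gamma$. The spin of a ribbon is its number of rows minus 1. For $k\ge1$, $D_ks(\lambda)=\sum_\mu(-v)^{-\mathrm{spin}(\mu/\lambda)}s(\mu)$, summed over $\mu$ such that $\mu/\lambda$ is a horizontal $n$-ribbon strip of weight $k$, i.e. $\mu/\lambda$ can be tiled by $k$ $n$-ribbons such that the top-right cell of each ribbon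 lies in the first row or immediately below a cell of $\lambda$; $\mathrm{spin}(\mu/\lambda)$ is the sum of the spins of these ribbons. The bar involution $x\mapsto\overline{x}$ of $\mathcal{F}_v$ is the unique semi-linear map ($\overline{q(v)x}=q(v^{-1})\overline{x}$) with $\overline{s(\emptyset)}=s(\emptyset)$, $\overline{F_ix}=F_i\overline{x}$, $\overline{D_kx}=D_k\overline{x}$ for all $i,k,x$. Let $L$ (resp. $L^-$) be the free $\mathbb{Z}[v]$-module (resp. $\mathbb{Z}[v^{-1}]$-module) with basis $\{s(\lambda)\}$. The bases $\{G(\lambda)\}$, $\{G^-(\lambda)\}$ of $\mathcal{F}_v$ are characterized by $\overline{G(\lambda)}=G(\lambda)$, $\overline{G^-(\lambda)}=G^-(\lambda)$, $G(\lambda)\equiv s(\lambda)\bmod vL$, $G^-(\lambda)\equiv s(\lambda)\bmod v^{-1}L^-$. The polynomials $d_{\lambda,\mu}(v)$, $e_{\lambda,\mu}(v)$ are defined by $$G(\mu)=\sum_\lambda d_{\lambda,\mu}(v)s(\lambda),\qquad G^-(\lambda)=\sum_\mu e_{\lambda,\mu}(-v^{-1})s(\mu).$$ *)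

(* Defs.v *)
From HB Require Import structures.
From mathcomp Require Import all_boot all_order all_algebra.
From mathcomp Require Import fraction generic_quotient.
From mathcomp Require Import reals.
From mathcomp.real_closed Require Import complex.
From mathcomp Require Import finmap zify.
From mathcomp.multinomials Require Import monalg.
From Stdlib Require Import Relation_Operators.

Set Implicit Arguments.
Unset Strict Implicit.
Unset Printing Implicit Defensive.

Import Order.TTheory GRing.Theory Num.Theory.
Local Open Scope ring_scope.

(* Rows and columns of Young diagrams are numbered from 0, so contents are
   the usual ones. *)

Definition is_intpart (s : seq nat) : bool := sorted geq s && (0%N \notin s).

Record intpart := IntPart { parts_of :> seq nat; _ : is_intpart parts_of }.

HB.instance Definition _ := [isSub for parts_of].
HB.instance Definition _ := [Countable of intpart by <:].

Definition empty_part : intpart := @IntPart [::] isT.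

Definition row_len (l : intpart) (a : nat) : nat := nth 0%N l a.

Definition psize (l : intpart) : nat := sumn l.

Definition parts (m : nat) : seq intpart :=
  [seq l <- undup (pmap insub
     [seq [seq x <- map val (val t) | x != 0%N] | t : m.-tuple 'I_m.+1])
   | psize l == m].

Lemma mem_parts m (l : intpart) : (l \in parts m) = (psize l == m).
Proof.
rewrite mem_filter; case: eqP => //= szl; rewrite mem_undup mem_pmap_sub.
case: l szl => s /= ps; rewrite /psize /= => szs.
have s0 : 0%N \notin s by case/andP: ps.
have len : (size s <= m)%N.
  rewrite -szs; elim: (s) s0 => //= x s' IH; rewrite inE negb_or eq_sym -lt0n.
  by case/andP=> x0 /IH h; rewrite -add1n; exact: leq_add.
have bd x : x \in s -> (x < m.+1)%N.
  rewrite ltnS -szs; elim: (s) => //= y s' IH; rewrite inE.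
  by case/predU1P=> [->|/IH h]; [exact: leq_addr | exact: leq_trans h (leq_addl _ _)].
pose f := [seq inord x : 'I_m.+1 | x <- s] ++ nseq (m - size s) ord0.
have szf : size f == m by rewrite size_cat size_map size_nseq subnKC.
apply/mapP; exists (Tuple szf); first by rewrite mem_enum.
rewrite /= map_cat filter_cat -map_comp map_nseq /=.
have -> : [seq x <- nseq (m - size s) 0%N | x != 0%N] = [::].
  by rewrite filter_nseq mul0n.
have -> : [seq val (inord x : 'I_m.+1) | x <- s] = s.
  by rewrite -[RHS]map_id; apply/eq_in_map => x /bd xm /=; rewrite inordK.
rewrite cats0; apply/esym/all_filterP/allP => x xs.
by apply: contraNneq s0 => <-.
Qed.

Lemma parts_uniq m : uniq (parts m).
Proof. by rewrite filter_uniq ?undup_uniq. Qed.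

Section Nodes.
Variables (n i : nat) (l : intpart).

Definition i_node (a b : nat) : bool :=
  ((b%:Z - a%:Z)%R == i%:Z %[mod n%:Z])%Z.

Definition addable (a : nat) : bool :=
  (a == 0)%N || (row_len l a < row_len l a.-1)%N.

Definition removable (a : nat) : bool := (row_len l a.+1 < row_len l a)%N.

Definition addable_i (a : nat) : bool := addable a && i_node a (row_len l a).

Definition removable_i (a : nat) : bool :=
  removable a && i_node a (row_len l a).-1.

(* Difference of the numbers of addable and of removable i-nodes in a column
   with number > b. *)
Definition Nr (b : nat) : int :=
  #|[set a : 'I_(size l).+1 | addable_i a && (b < row_len l a)%N]|%:Z
  - #|[set a : 'I_(size l).+1 | removable_i a && (b < (row_len l a).-1)%N]|%:Z.

Definition add_node (a : nat) : intpart := insubd empty_part (incr_nth l a).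

Lemma add_nodeE (a : nat) : (a <= size l)%N -> addable a ->
  add_node a = incr_nth l a :> seq nat.
Proof.
move=> las ad; rewrite /add_node val_insubd ifT //; apply/andP; split.
  have sl : sorted geq l := proj1 (andP (valP l)).
  apply/(sortedP 0%N) => b; rewrite size_incr_nth => hb /=.
  rewrite !nth_incr_nth.
  have h : (nth 0 l b.+1 <= nth 0 l b)%N.
    case: (ltnP b.+1 (size l)) => hs; first by move/(sortedP 0%N)/(_ b hs): (sl).
    by rewrite (nth_default _ hs).
  case: (a =P b.+1) => [ab|_]; last first.
    by rewrite add0n (leq_trans h) ?leq_addl.
  by move: ad; rewrite /addable ab /= /row_len add1n => /leq_trans -> //; exact: leq_addl.
have l0 : 0%N \notin parts_of l := proj2 (andP (valP l)).
apply/negP => /(nthP 0%N)[b]; rewrite size_incr_nth nth_incr_nth => hb.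
move/eqP; rewrite addn_eq0 eqb0 => /andP[nab /eqP b0].
case: (ltnP b (size l)) => hs; first by move: l0; rewrite -b0 mem_nth.
by move: hb nab las hs; case: ifP; lia.
Qed.

Lemma scopes_pi_subproof :
  is_intpart [seq x <- mkseq (fun a => row_len l a - removable_i a)%N (size l)
             | x != 0%N].
Proof.
apply/andP; split; last by rewrite mem_filter.
have tr : transitive geq by move=> y x z /= h1 h2; exact: leq_trans h2 h1.
apply: (sorted_filter tr).
have sl : sorted geq l := proj1 (andP (valP l)).
apply/(sortedP 0%N) => a; rewrite size_mkseq => ha.
rewrite !nth_mkseq ?(ltnW ha) //=.
have h : (row_len l a.+1 <= row_len l a)%N by move/(sortedP 0%N)/(_ a ha): (sl).
rewrite /removable_i; case: (boolP (removable a)) => [|_] /=; last first.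
  by rewrite subn0 (leq_trans (leq_subr _ _)).
rewrite /removable => h'; apply: leq_trans (leq_subr _ _) _.
by case: (i_node _ _) => //=; rewrite ?subn0 // subn1 -ltnS (ltn_predK h').
Qed.

(* The removable i-nodes lie in distinct rows, and all of them can be removed
   at once. *)
Definition scopes_pi : intpart := IntPart scopes_pi_subproof.

End Nodes.

Section Abacus.
Variable n : nat.

(* Since rows are numbered from 0, this is the beta-number l_(k+1) - (k+1) + 1.
   Runner c consists of the integers congruent to c modulo n, so runner n is
   that of the multiples of n. *)
Definition beta (l : intpart) (k : nat) : int := (row_len l k)%:Z - k%:Z.

Definition bead (l : intpart) (x : int) : bool :=
  [exists k : 'I_(size l), beta l k == x] || (x <= - (size l)%:Z).

Lemma beadP (l : intpart) (x : int) :
  reflect (exists k, beta l k = x) (bead l x).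
Proof.
apply: (iffP orP) => [[/existsP[k /eqP <-]|lex]|[k <-]]; first by exists k.
  have [m xm] : exists m : nat, x = - m%:Z.
    exists `|x|%N; rewrite abszE ler0_norm ?opprK //.
    by apply: le_trans lex _; rewrite oppr_le0.
  exists m; move: lex; rewrite xm lerN2 lez_nat => sm.
  by rewrite /beta /row_len nth_default // sub0r.
case: (ltnP k (size l)) => [lk|lk]; [left|right].
  by apply/existsP; exists (Ordinal lk).
by rewrite /beta /row_len nth_default // sub0r lerN2 lez_nat.
Qed.

(* Only beads k < size l can be positive, and only the positions -j with
   j < size l can be vacant and nonpositive. *)
Definition charge (l : intpart) (c : nat) : int :=
  #|[set k : 'I_(size l) | (0 < beta l k)
                           && (beta l k == c%:Z %[mod n%:Z])%Z]|%:Z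
  - #|[set j : 'I_(size l) | ~~ bead l (- j%:Z)
                           && ((- j%:Z)%R == c%:Z %[mod n%:Z])%Z]|%:Z.

(* m is obtained from l by moving one bead to the preceding position of its
   runner, which is vacant. *)
Definition slide (l m : intpart) : Prop :=
  exists x : int, [/\ bead l x, ~~ bead l (x - n%:Z) &
    forall y, bead m y = (y == x - n%:Z) || (bead l y && (y != x))].

Definition is_core (l : intpart) : Prop :=
  forall x, bead l x -> bead l (x - n%:Z).

Definition has_core (l t : intpart) : Prop :=
  clos_refl_trans intpart slide l t /\ is_core t.

Definition P0 (t : intpart) (w : nat) (l : intpart) : Prop :=
  has_core l t /\ psize l = (psize t + n * w)%N.

Definition scopes_k (t : intpart) (i : nat) : int :=
  if i == 0%N then charge t 1 - charge t n - 1
  else charge t i.+1 - charge t i.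

End Abacus.

Section Ribbons.
Variables (n k : nat) (l m : intpart).

Local Notation cell := ('I_(psize m) * 'I_(psize m))%type.

Definition in_skew (c : cell) : bool :=
  (row_len l c.1 <= c.2 < row_len m c.1)%N.

Definition sub_part : bool := [forall a : 'I_(size l), row_len l a <= row_len m a]%N.

(* A ribbon is listed from its top-right cell to its bottom-left one: every
   cell is followed by its left or by its lower neighbour. *)
Definition ribbon_step (c d : cell) : bool :=
  ((d.1 == c.1) && (c.2 == d.2.+1 :> nat))
  || ((d.2 == c.2) && (d.1 == c.1.+1 :> nat)).

Definition is_ribbon (t : n.-tuple cell) : bool := sorted ribbon_step t.

Definition ribbon_spin (t : n.-tuple cell) : nat :=
  (size (undup [seq c.1 | c <- t])).-1.

(* The top-right cell lies in the first row or immediately below a cell of l. *)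
Definition head_ok (t : n.-tuple cell) : bool :=
  if val t is c :: _ then (c.1 == 0%N :> nat) || (c.2 < row_len l c.1.-1)%N
  else false.

Definition horizontal_tiling (T : {set n.-tuple cell}) : bool :=
  [&& sub_part, #|T| == k, [forall t in T, is_ribbon t && head_ok t]
    & [forall c, #|[set t in T | c \in val t]| == in_skew c]].

(* The tiling of a horizontal ribbon strip is unique, hence so is its spin. *)
Definition strip_spin : option nat :=
  omap (fun T : {set n.-tuple cell} => \sum_(t in T) ribbon_spin t)%N
    [pick T | horizontal_tiling T].

End Ribbons.

Local Notation tofrac := (@FracField.tofrac _).
Local Notation "x %:F" := (tofrac x).

Section RatFun.
Variable R : realType.

Local Notation K := {fraction {poly R[i]}}.

Definition v : K := ('X : {poly R[i]})%:F.

Definition cst (z : R[i]) : K := (z%:P)%:F.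

Definition eval_at (t : K) (p : {poly R[i]}) : K := (map_poly cst p).[t].

(* q(v) |-> q(v^-1); independent of the chosen representative of q, see
   subst_vinvE below. *)
Definition subst_vinv (q : K) : K :=
  eval_at v^-1 \n_(repr q) / eval_at v^-1 \d_(repr q).

Lemma v_neq0 : v != 0.
Proof. by rewrite tofrac_eq0 polyX_eq0. Qed.

Lemma cst_is_zmod_morphism : zmod_morphism cst.
Proof. by move=> x y; rewrite /cst !rmorphB. Qed.
Lemma cst_is_monoid_morphism : monoid_morphism cst.
Proof. by split=> [|x y]; rewrite /cst ?rmorph1 // !rmorphM. Qed.
HB.instance Definition _ :=
  GRing.isZmodMorphism.Build R[i] K cst cst_is_zmod_morphism.
HB.instance Definition _ :=
  GRing.isMonoidMorphism.Build R[i] K cst cst_is_monoid_morphism.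

Lemma eval_atM t p q : eval_at t (p * q) = eval_at t p * eval_at t q.
Proof. by rewrite /eval_at rmorphM hornerM. Qed.

Lemma eval_vinv_neq0 p : p != 0 -> eval_at v^-1 p != 0.
Proof.
move=> p0; apply/eqP => e0.
have sp : (0 < size p)%N by rewrite size_poly_gt0.
pose r : {poly R[i]} := \sum_(j < size p) p`_j *: 'X^((size p).-1 - j).
have rE : r%:F = v ^+ (size p).-1 * eval_at v^-1 p.
  rewrite /eval_at horner_coef size_map_poly mulr_sumr rmorph_sum /=.
  apply: eq_bigr => j _; rewrite coef_map /= -mul_polyC rmorphM /= rmorphXn /=.
  rewrite mulrCA -/(cst _); congr (_ * _).
  have le : (j <= (size p).-1)%N by rewrite -ltnS prednK.
  by rewrite exprVn -{2}(subnK le) exprD mulfK // expf_neq0 // v_neq0.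
move/eqP: rE; rewrite e0 mulr0 tofrac_eq0 => /eqP r0.
have /eqP := congr1 (fun q : {poly R[i]} => q`_0) r0.
rewrite coef0 coef_sum.
have lt : ((size p).-1 < size p)%N by rewrite prednK.
rewrite (bigD1 (Ordinal lt)) //= subnn coefZ coefXn mulr1 big1 => [|j nj].
  by rewrite addr0 -lead_coefE lead_coef_eq0 (negPf p0).
rewrite coefZ coefXn eq_sym subn_eq0 leqNgt ltn_neqAle.
have -> : (j != (size p).-1 :> nat) by [].
by rewrite -ltnS prednK // ltn_ord mulr0.
Qed.

Lemma pi_ratioE (x : {ratio {poly R[i]}}) :
  (\pi_(FracField.type {poly R[i]})%qT x) = (\n_x)%:F / (\d_x)%:F.
Proof.
have e : \d_x != 0 := denom_ratioP x.
unlock FracField.tofrac; rewrite -[(_)^-1]FracField.pi_inv -[RHS]FracField.pi_mul.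
rewrite /FracField.invf /FracField.mulf !numden_Ratio ?oner_neq0 //.
by rewrite mulr1 mul1r Ratio_numden.
Qed.

Lemma subst_vinvE p q :
  q != 0 -> subst_vinv (p%:F / q%:F) = eval_at v^-1 p / eval_at v^-1 q.
Proof.
move=> q0; rewrite /subst_vinv; set x := repr _.
have dx : \d_x != 0 by exact: denom_ratioP.
apply/eqP; rewrite eqr_div ?eval_vinv_neq0 // -!eval_atM; apply/eqP; congr eval_at.
have xE : (\n_x)%:F / (\d_x)%:F = p%:F / q%:F.
  by rewrite -[RHS]reprK -/x pi_ratioE.
move/eqP: xE; rewrite eqr_div ?tofrac_eq0 // -!rmorphM /= tofrac_eq => /eqP ->.
by [].
Qed.

End RatFun.

Section Fock.
Variable R : realType.

Local Notation K := {fraction {poly R[i]}}.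

Definition fock := {malg K[intpart]}.

Definition fock_s (l : intpart) : fock := << l >>.

Definition lin_ext (f : intpart -> fock) (x : fock) : fock :=
  \sum_(l <- msupp x) x@_l *: f l.

Definition fock_F (n i : nat) : fock -> fock := lin_ext (fun l =>
  \sum_(a < (size l).+1 | addable_i n i l a)
     v R ^ Nr n i l (row_len l a) *: fock_s (add_node l a)).

Definition fock_D (n k : nat) : fock -> fock := lin_ext (fun l =>
  \sum_(m <- parts (psize l + n * k)%N)
     if strip_spin n k l m is Some d then (- v R) ^- d *: fock_s m else 0).

Definition is_bar (n : nat) (bar : fock -> fock) : Prop :=
  [/\ forall (q : K) x y, bar (q *: x + y) = subst_vinv q *: bar x + bar y,
      bar (fock_s empty_part) = fock_s empty_part,
      forall i x, (i < n)%N -> bar (fock_F n i x) = fock_F n i (bar x)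
    & forall k x, (0 < k)%N -> bar (fock_D n k x) = fock_D n k (bar x)].

Definition int_eval (t : K) (p : {poly int}) : K := (map_poly intr p).[t].

(* lattice v is L and lattice v^-1 is L^- *)
Definition lattice (t : K) (x : fock) : Prop :=
  forall l, exists p, x@_l = int_eval t p.

(* For t = v (resp. t = v^-1) this characterizes the basis G (resp. G^-). *)
Definition is_canonical_basis (bar : fock -> fock) (t : K)
    (G : intpart -> fock) : Prop :=
  forall l, bar (G l) = G l /\ exists2 y, lattice t y & G l - fock_s l = t *: y.

Definition is_d (G : intpart -> fock) (d : intpart -> intpart -> {poly int}) :
    Prop := forall l m, (G m)@_l = int_eval (v R) (d l m).

Definition is_e (Gm : intpart -> fock) (e : intpart -> intpart -> {poly int}) :
    Prop := forall l m, (Gm l)@_m = int_eval (- (v R)^-1) (e l m).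

End Fock.

(* Main.v *)
(* If l has no addable i-node and k removable ones, then F_i^k maps
   s(pi_i(l)) to [k]! s(l), where [k]! is nonzero and bar invariant.  The
   quadratic form computing the n-weight from the residue content shows that a
   partition with r removable and s addable i-nodes has n-weight at least r s.
   Since w <= k_i, every partition with the residue content of pi_i(m), m in
   P_0(tau, w), therefore has no removable i-node and exactly k_i addable ones.
   So F_i^k G(pi_i(m)) / [k]! is bar invariant and congruent to s(m) modulo v L;
   by uniqueness it is G(m), and its coefficients are those of G(pi_i(m)).

   Uniqueness and homogeneity of G have to be derived from the existence of bar,
   G and G^-.  The F_i and D_k generate the Fock space from s(0), by a
   triangularity argument at v = oo; hence bar preserves the residue content.
   On a finite-dimensional weight space let g and h be the matrices of G and
   G^-, and a that of bar: then g = bar(g) a and h = bar(h) a, so that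
   det(g) bar(det(h)) is bar invariant.  It is a polynomial in v with constant
   term 1, hence equal to 1, and g is invertible over Z[v].  An invariant vector
   of v L then has coordinates in v Z[v] in the basis G, and these are invariant
   under v -> 1/v, so they vanish. *)

Require Import Defs.
From HB Require Import structures.
From mathcomp Require Import all_boot all_order all_algebra.
From mathcomp Require Import fraction.
From mathcomp Require Import reals.
From mathcomp.real_closed Require Import complex.
From mathcomp Require Import finmap zify ring.
From mathcomp.multinomials Require Import monalg.

Set Implicit Arguments.
Unset Strict Implicit.
Unset Printing Implicit Defensive.

Import Order.TTheory GRing.Theory Num.Theory.
Local Open Scope ring_scope.

(** * Partitions and residues *)

(** [is_bar] only provides commutation relations. The unitriangularity of the bar involution, from
    which uniqueness of canonical bases is usually deduced, is not at hand; the simultaneous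
    existence of [G] and [G^-] replaces it, since one is integral over v and the other over 1/v,
    which leaves room for constants only. The F_i alone generate a proper subspace of the Fock
    space. The D_k serve for the partitions all of whose parts are divisible by n: there D_k creates
    the last row out of horizontal bars. For any other partition some residue i has a removable node
    whose signature makes it dominate F_i at v = oo. The weight bound rests on the abacus: the
    quadratic form is twice the total displacement of the beads from their lowest positions, hence
    nonnegative on every partition, whatever its core. *)

Lemma row_len_sorted (l : intpart) a b :
  (a <= b)%N -> (row_len l b <= row_len l a)%N.
Proof.
have sl : sorted geq l := proj1 (andP (valP l)).
have step c : (row_len l c.+1 <= row_len l c)%N.
  rewrite /row_len; case: (ltnP c.+1 (size l)) => hs; last by rewrite nth_default.
  by move/(sortedP 0%N)/(_ c hs): sl.
by move/subnK <-; elim: (b - a)%N => // k IH; rewrite addSn (leq_trans (step _)).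
Qed.

Lemma row_len_eq0 (l : intpart) a : (row_len l a == 0)%N = (size l <= a)%N.
Proof.
have l0 : 0%N \notin parts_of l := proj2 (andP (valP l)).
case: leqP => la; first by rewrite /row_len nth_default.
by apply/negbTE; apply: contraNneq l0 => <-; rewrite mem_nth.
Qed.

Lemma row_len_ext (l m : intpart) :
  (forall a, row_len l a = row_len m a) -> l = m.
Proof.
move=> h; apply/val_inj/(@eq_from_nth _ 0%N) => [|a _]; last exact: h.
have e a : (size l <= a)%N = (size m <= a)%N by rewrite -!row_len_eq0 h.
by apply/eqP; rewrite eqn_leq e leqnn -e leqnn.
Qed.

Definition mkpart (s : seq nat) : intpart :=
  insubd empty_part [seq x <- s | x != 0%N].

Lemma row_len_mkpart s a : sorted geq s -> row_len (mkpart s) a = nth 0%N s a.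
Proof.
move=> ss; have tr : transitive geq by move=> y x z /= h1 h2; exact: leq_trans h2 h1.
rewrite /row_len /mkpart val_insubd ifT; last first.
  by rewrite /is_intpart mem_filter eqxx /= andbT sorted_filter.
elim: s ss a => [//|x s IH] /= ss a; have ss' := path_sorted ss.
case: (altP (x =P 0%N)) => [x0|_] /=; last by case: a => [|a] //=; exact: IH.
have s0 b : nth 0%N s b = 0%N.
  case: (ltnP b (size s)) => hb; last by rewrite nth_default.
  by have /allP/(_ _ (mem_nth 0%N hb)) := order_path_min tr ss; rewrite /= x0; lia.
by rewrite IH // s0; case: a => [|a] /=; rewrite ?x0 ?s0.
Qed.

Lemma row_len_mkpart_mkseq f N a : (forall b, (b.+1 < N)%N -> (f b.+1 <= f b)%N) ->
  row_len (mkpart (mkseq f N)) a = if (a < N)%N then f a else 0%N.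
Proof.
move=> h; rewrite row_len_mkpart.
  by case: ltnP => aN; [rewrite nth_mkseq | rewrite nth_default ?size_mkseq].
apply/(sortedP 0%N) => b; rewrite size_mkseq => bN.
by rewrite /= !nth_mkseq ?h // ltnW.
Qed.

Lemma psizeE (l : intpart) N : (size l <= N)%N ->
  psize l = (\sum_(a < N) row_len l a)%N.
Proof.
move=> lN; rewrite /psize sumnE (big_nth 0%N) big_mkord.
rewrite -(subnKC lN) big_split_ord /= [X in (_ + X)%N]big1 ?addn0 // => a _.
by apply/eqP; rewrite row_len_eq0 leq_addr.
Qed.

Lemma beta_lt (l : intpart) a b : (a < b)%N -> beta l b < beta l a.
Proof. by rewrite /beta => ab; have := row_len_sorted l (ltnW ab); lia. Qed.

Lemma beta_inj (l : intpart) : injective (beta l).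
Proof.
by move=> a b e; case: (ltngtP a b) => // /(beta_lt l); rewrite e ltxx.
Qed.

Section Residues.
Variable n : nat.
Hypothesis n_gt1 : (1 < n)%N.

Definition has_res (r c : int) : bool := (c == r %[mod n%:Z])%Z.

Local Notation res := has_res.

Lemma resE r c : res r c = (n%:Z %| c - r)%Z.
Proof. by rewrite /has_res eqz_mod_dvd. Qed.

Lemma res_shift r c d : res (r + d) (c + d) = res r c.
Proof. by rewrite !resE opprD addrACA subrr addr0. Qed.

Lemma res_succ r c : res r c -> ~~ res r (c + 1).
Proof.
rewrite !resE => h; have -> : c + 1 - r = (c - r) + 1 by ring.
by rewrite rpredDl ?h // dvdz1; lia.
Qed.

Lemma res_pred r c : res r c -> ~~ res r (c - 1).
Proof. by move=> h; apply/negP => /res_succ; rewrite subrK h. Qed.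

End Residues.

Lemma addable_size (l : intpart) a : addable l a -> (a <= size l)%N.
Proof.
case: a => // a; rewrite /addable /= => h.
by rewrite ltnNge -row_len_eq0 -lt0n (leq_ltn_trans _ h).
Qed.

Lemma removable_size (l : intpart) a : removable l a -> (a < size l)%N.
Proof. by move=> h; rewrite ltnNge -row_len_eq0 -lt0n (leq_ltn_trans _ h). Qed.

Lemma row_len_add (l : intpart) a b : addable l a ->
  row_len (add_node l a) b = ((b == a) + row_len l b)%N.
Proof.
by move=> ad; rewrite /row_len add_nodeE ?addable_size // nth_incr_nth eq_sym.
Qed.

Section Nodes.
Variables (n : nat) (i : nat).
Hypothesis n_gt1 : (1 < n)%N.

Lemma addable_iE l a : addable_i n i l a = addable l a && has_res n i (beta l a).
Proof. by []. Qed.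

Lemma removable_iE l a :
  removable_i n i l a = removable l a && has_res n i (beta l a - 1).
Proof.
rewrite /removable_i; case: (boolP (removable l a)) => //= ra.
rewrite /i_node -/(has_res n i _); congr (has_res n i _).
by move: ra; rewrite /removable /beta; lia.
Qed.

Lemma addable_i_size l a : addable_i n i l a -> (a <= size l)%N.
Proof. by case/andP => /addable_size. Qed.

Lemma removable_i_size l a : removable_i n i l a -> (a < size l)%N.
Proof. by case/andP => /removable_size. Qed.

Lemma addable_removable_i l a : addable_i n i l a -> ~~ removable_i n i l a.
Proof.
rewrite addable_iE removable_iE => /andP[_ h].
by rewrite (negPf (res_pred n_gt1 h)) andbF.
Qed.

Section AddNode.
Variables (l : intpart) (a : nat).
Hypothesis ad : addable_i n i l a.

Let adl : addable l a. Proof. by case/andP: ad. Qed.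
Let resa : has_res n i (beta l a). Proof. by case/andP: ad. Qed.
Let m := add_node l a.

Lemma beta_add y : beta m y = (y == a)%:Z + beta l y.
Proof. by rewrite /beta row_len_add // PoszD addrA. Qed.

(** Apart from the filled position itself, addability changes only next to the new node, at cells
    whose content differs from that of the node by one; for n > 1 these do not have residue i. *)
Lemma addable_i_add y : addable_i n i m y = addable_i n i l y && (y != a).
Proof.
rewrite !addable_iE beta_add; case: eqP => [->|/eqP ya].
  by rewrite andbF addrC (negPf (res_succ n_gt1 resa)) andbF.
rewrite add0r andbT /addable; case: y ya => [|y] //= ya.
rewrite !row_len_add // (negPf ya) /=.
case: eqP => [yE|_]; last by [].
subst y; have h := row_len_sorted l (leqnSn a).
case: (ltngtP (row_len l a.+1) (row_len l a)) h => // [h _|e _].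
  by rewrite ltnS add0n (ltnW h).
suff -> : has_res n i (beta l a.+1) = false by rewrite andbF.
have -> : beta l a.+1 = beta l a - 1 by rewrite /beta e; lia.
by apply/negbTE/res_pred.
Qed.

Lemma removable_i_add y : removable_i n i m y = removable_i n i l y || (y == a).
Proof.
rewrite !removable_iE beta_add; case: eqP => [->|/eqP ya].
  rewrite orbT -addrA addrCA subrr addr0 resa andbT /removable !row_len_add //.
  by rewrite eqxx -(eqn_add2l a) addnS (gtn_eqF (leqnn _)) ltnS row_len_sorted.
rewrite add0r orbF /removable !row_len_add // (negPf ya) add0n.
case: eqP => [yE|_]; last by [].
have h : (row_len l a < row_len l y)%N by move: adl; rewrite /addable -yE.
rewrite yE h /= add1n; case: (ltngtP (row_len l a).+1 (row_len l y)) h => // e _.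
suff -> : has_res n i (beta l y - 1) = false by [].
have -> : beta l y - 1 = beta l a + 1 by rewrite /beta -e -yE; lia.
by apply/negbTE/res_succ.
Qed.

End AddNode.

(** The exponent [Nr] read by rows instead of columns ([NrE]). In this form it makes sense for every
    row, and it changes by at most one from a row to the next. *)
Definition height (l : intpart) (a : nat) : int :=
  \sum_(y < a) ((addable_i n i l y)%:Z - (removable_i n i l y)%:Z).

Lemma heightS l a :
  height l a.+1 = height l a + (addable_i n i l a)%:Z - (removable_i n i l a)%:Z.
Proof. by rewrite /height big_ord_recr /= addrA. Qed.

Lemma card_set_rows (P Q : pred nat) N a : (a <= N)%N ->
  (forall y, P y = Q y && (y < a)%N) ->
  #|[set y : 'I_N | P y]|%:Z = \sum_(y < a) (Q y)%:Z.
Proof.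
move=> aN h; rewrite cardsE -sum1_card (big_morph Posz PoszD (erefl _)) /=.
rewrite (eq_bigl (fun y : 'I_N => Q y && (y < a)%N)) => [|y]; last first.
  by rewrite unfold_in /= h.
rewrite (big_ord_widen_cond N xpredT (fun y => (Q y)%:Z)) //= big_mkcond.
by rewrite [RHS]big_mkcond; apply: eq_bigr => y _; case: (Q y); case: ltnP.
Qed.

Lemma NrE l a : addable_i n i l a -> Nr n i l (row_len l a) = height l a.
Proof.
move=> ad; have la := addable_i_size ad; rewrite /Nr /height sumrB; congr (_ - _).
  apply: (@card_set_rows (fun y => addable_i n i l y && (row_len l a < row_len l y)%N)
    (addable_i n i l)) => [|y]; first exact: leqW.
  case: (boolP (addable_i n i l y)) => //= /andP[ay _].
  case: (leqP a y) => ya; first by have := row_len_sorted l ya; lia.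
  case/andP: ad; rewrite /addable; case: (a) ya => // b; rewrite ltnS => yb /= h _.
  by have := row_len_sorted l yb; lia.
apply: (@card_set_rows (fun y => removable_i n i l y && (row_len l a < (row_len l
  y).-1)%N)
  (removable_i n i l)) => [|y]; first exact: leqW.
case: (boolP (removable_i n i l y)) => //=; rewrite removable_iE => /andP[ry r].
case: (leqP a y) => ya; first by have := row_len_sorted l ya; lia.
case/andP: ad; rewrite /addable; case: (a) ya => // b; rewrite ltnS => yb /= h.
rewrite -/(has_res n i _) => ra; have := row_len_sorted l yb.
(* The borderline case is a removable node in the column of the addable one, hence just above it;
   the two contents differ by one, so both cannot be i-nodes. *)
case: (eqVneq (row_len l b.+1).+1 (row_len l y)) => [e|]; last by lia.
case: (ltngtP y b) yb => // [yb _|yb _].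
  by move: ry; rewrite /removable; have := row_len_sorted l yb; lia.
case/negP: (res_succ n_gt1 ra); subst y.
by move: r; rewrite /beta -e; congr (has_res _ _ _); lia.
Qed.

End Nodes.

(** * The Fock space operators as linear maps *)

Section FockSpace.
Variable R : realType.
Local Notation K := {fraction {poly R[i]}}.
Local Notation fock := (fock R).
Local Notation v := (v R).
Local Notation s := (fock_s R).

Lemma fock_sE l m : (s l)@_m = (l == m)%:R :> K.
Proof. exact: mcoeffU. Qed.

Lemma lin_extEw (f : intpart -> fock) (x : fock) (D : {fset intpart}) :
  (msupp x `<=` D)%fset -> lin_ext f x = \sum_(l <- D) x@_l *: f l.
Proof.
move=> xD; rewrite /lin_ext [RHS](big_fsetID _ (mem (msupp x))) /=.
rewrite [X in _ = _ + X]big1_fset ?addr0 => [|l]; last first.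
  by rewrite !inE => /andP[_ h] _; rewrite mcoeff_outdom ?scale0r.
apply: eq_fbigl => l; rewrite !inE /= andbC; case: (boolP (l \in msupp x)) => //= h.
by rewrite (fsubsetP xD).
Qed.

Lemma lin_ext_is_linear (f : intpart -> fock) : linear (lin_ext f).
Proof.
move=> a x y; pose D := (msupp x `|` msupp y)%fset.
rewrite (@lin_extEw f x D) ?fsubsetUl // (@lin_extEw f y D) ?fsubsetUr //.
rewrite (@lin_extEw f (a *: x + y) D); last first.
  by rewrite (fsubset_trans (msuppD_le _ _)) // fsetSU // msuppZ_le.
rewrite scaler_sumr -big_split /=; apply: eq_bigr => l _.
by rewrite mcoeffD mcoeffZ scalerDl scalerA.
Qed.

HB.instance Definition _ (f : intpart -> fock) :=
  GRing.isLinear.Build K fock fock *:%R (lin_ext f) (lin_ext_is_linear f).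

Lemma lin_ext_s (f : intpart -> fock) l : lin_ext f (s l) = f l.
Proof.
by rewrite /lin_ext msuppU oner_eq0 big_seq_fset1 fock_sE eqxx scale1r.
Qed.

Lemma fock_sum (x : fock) : x = \sum_(l <- msupp x) x@_l *: s l.
Proof.
apply/malgP => m; rewrite {1}(monalgE x) !raddf_sum; apply: eq_bigr => l _ /=.
by rewrite mcoeffZ fock_sE mcoeffU mulr_natr.
Qed.

Lemma lin_ext_coef (f : intpart -> fock) x m :
  (lin_ext f x)@_m = \sum_(l <- msupp x) x@_l * (f l)@_m.
Proof. by rewrite /lin_ext raddf_sum; apply: eq_bigr => l _; rewrite /= mcoeffZ. Qed.

HB.instance Definition _ (n i : nat) := GRing.isLinear.Build K fock fock *:%R
  (@fock_F R n i) (lin_ext_is_linear _).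

HB.instance Definition _ (n k : nat) := GRing.isLinear.Build K fock fock *:%R
  (@fock_D R n k) (lin_ext_is_linear _).

Lemma fock_Fs n i l : (1 < n)%N -> fock_F n i (s l) =
  \sum_(a < (size l).+1 | addable_i n i l a) v ^ height n i l a *: s (add_node l a).
Proof.
by move=> n1; rewrite /fock_F lin_ext_s; apply: eq_bigr => a ad; rewrite NrE.
Qed.

Lemma fock_Ds n k l : fock_D n k (s l) =
  \sum_(m <- parts (psize l + n * k)%N)
     if strip_spin n k l m is Some d then (- v) ^- d *: s m else 0.
Proof. exact: lin_ext_s. Qed.

End FockSpace.

(** * Adding all addable nodes of a residue *)

Lemma mulr_expz_collect (F : fieldType) (x q : F) (a b c d : int) :
  x != 0 -> a + b = c + d -> x ^ a * (q * x ^ b) = q * x ^ c * x ^ d.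
Proof. by move=> x0 e; rewrite mulrCA -mulrA -!expfzDr // e. Qed.

Section FPower.
Variables (R : realType) (n i : nat).
Hypothesis n_gt1 : (1 < n)%N.
Local Notation K := {fraction {poly R[i]}}.
Local Notation v := (v R).
Local Notation s := (fock_s R).
Local Notation A := (addable_i n i).
Local Notation Rm := (removable_i n i).

Definition add_all (l : intpart) : intpart :=
  mkpart (mkseq (fun a => row_len l a + A l a)%N (size l).+1).

Lemma row_len_add_all l a : row_len (add_all l) a = (row_len l a + A l a)%N.
Proof.
rewrite row_len_mkpart_mkseq => [|b _]; last first.
  have := row_len_sorted l (leqnSn b); rewrite leq_eqVlt; case/predU1P => [e|];
    last by lia.
  suff -> : A l b.+1 = false by lia.
  by rewrite addable_iE /addable /= e ltnn.
case: ltnP => // la; case: (boolP (A l a)) => [/addable_i_size|_]; first by lia.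
by rewrite addn0; apply/esym/eqP; rewrite row_len_eq0 ltnW.
Qed.

(** The symmetric quantum integer (v^m - v^-m) / (v - v^-1). *)
Definition qint (m : nat) : K := \sum_(j < m) v ^ (j%:Z *+ 2 + 1 - m%:Z).
Definition qfact (m : nat) : K := \prod_(j < m) qint j.+1.

Definition above (P : pred nat) (a : nat) : nat := \sum_(x < a) P x.

Lemma aboveS P a : above P a.+1 = (above P a + P a)%N.
Proof. by rewrite /above big_ord_recr. Qed.

Lemma sum_above (V : nmodType) (P : pred nat) (f : nat -> V) N :
  \sum_(a < N | P a) f (above P a) = \sum_(j < above P N) f j.
Proof.
elim: N => [|N IH]; first by rewrite /above !big_ord0.
rewrite big_mkcond big_ord_recr /= -big_mkcond /= {}IH aboveS.
by case: (P N); rewrite ?addn1 ?big_ord_recr //= addn0 addr0.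
Qed.

(** Counts the pairs of a removable i-node above an addable one. It measures how far the coefficient
    in [fock_F_iter] is from a quantum factorial; the induction needs it even when [l] has no
    removable i-node, because every added node becomes removable. *)
Definition inversions (l : intpart) (N : nat) : nat :=
  \sum_(y < N | A l y) above (Rm l) y.

(** Filling row a destroys its pairs with the removable rows above it, and creates one pair with
    each addable row below it. *)
Lemma inversions_add l a N : (forall y, A l y -> (y < N)%N) -> A l a ->
  (inversions (add_node l a) N + above (Rm l) a + above (A l) a + 1
   = inversions l N + above (A l) N)%N.
Proof.
move=> lN ad; have aN := lN _ ad.
have eA y : A (add_node l a) y = A l y && (y != a) by rewrite (addable_i_add n_gt1 ad).
have eR y : above (Rm (add_node l a)) y = (above (Rm l) y + (a < y))%N.
  rewrite /above; elim: y => [|y IH]; first by rewrite !big_ord0.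
  rewrite !big_ord_recr /= IH removable_i_add // -!addnA; congr (_ + _)%N.
  case: (ltngtP a y) => [ay|ay|<-]; rewrite ?orbF ?orbT ?addn0 ?ltnS.
  - by rewrite (ltnW ay) addnC.
  - by rewrite leqNgt ay addn0.
  - by rewrite leqnn (negPf (addable_removable_i n_gt1 ad)).
have -> : inversions (add_node l a) N
    = (\sum_(y < N | A l y && (y != a :> nat)) above (Rm l) y
       + \sum_(y < N | A l y && (y != a :> nat)) (a < y))%N.
  by rewrite -big_split; apply: eq_big => [y|y _]; rewrite ?eA ?eR.
have -> : inversions l N
    = (above (Rm l) a + \sum_(y < N | A l y && (y != a :> nat)) above (Rm l) y)%N.
  exact: (bigD1 (Ordinal aN)).
suff : (\sum_(y < N | A l y && (y != a :> nat)) (a < y) + above (A l) a + 1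
   = above (A l) N)%N by lia.
elim: (N) aN => // M IH; rewrite ltnS leq_eqVlt.
rewrite big_mkcond big_ord_recr -big_mkcond /= aboveS => /predU1P[<-|aM].
  rewrite eqxx andbF addn0 ad big1 // => y _; by rewrite ltnNge ltnW.
by rewrite -IH // aM (gtn_eqF aM) andbT; case: (A l M) => /=; lia.
Qed.

Lemma sum_rows_widen (V : nmodType) (P : pred nat) (f : nat -> V) M N :
  (forall y, P y -> (y < M)%N) -> (forall y, P y -> (y < N)%N) ->
  \sum_(a < M | P a) f a = \sum_(a < N | P a) f a.
Proof.
wlog MN : M N / (M <= N)%N => [h hM hN|hM _].
  by case/orP: (leq_total M N) => MN; [exact: h | apply/esym/h].
rewrite (big_ord_widen_cond N) //; apply: eq_bigl => a.
by case: (boolP (P a)) => // /hM ->.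
Qed.

Lemma fock_F_widen l N : (forall y, A l y -> (y < N)%N) -> fock_F n i (s l) =
  \sum_(a < N | A l a) v ^ height n i l a *: s (add_node l a).
Proof.
move=> lN; rewrite fock_Fs //.
by apply: (sum_rows_widen (fun a => v ^ height n i l a *: s (add_node l a))) => // y
  /addable_i_size.
Qed.

Lemma add_all_add l a : A l a -> add_all (add_node l a) = add_all l.
Proof.
move=> ad; apply: row_len_ext => y; rewrite !row_len_add_all (addable_i_add n_gt1 ad).
rewrite row_len_add; last by case/andP: ad.
by case: eqP => [->|_]; rewrite ?ad ?andbT ?andbF; lia.
Qed.

Lemma add_all_id l : (forall y, ~~ A l y) -> add_all l = l.
Proof.
by move=> h; apply: row_len_ext => y; rewrite row_len_add_all (negPf (h y)) addn0.
Qed.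

Lemma heightE l a : height n i l a = (above (A l) a)%:Z - (above (Rm l) a)%:Z.
Proof.
elim: a => [|a IH]; first by rewrite /height /above !big_ord0.
by rewrite heightS IH !aboveS; lia.
Qed.

(** Every order of filling the m addable rows ends at [add_all l]; the choice of the first node
    contributes a quantum integer. The bound N stays fixed along the induction, whereas the size of
    the partition may grow. *)
Lemma fock_F_iter l N m : (forall y, A l y -> (y < N)%N) -> above (A l) N = m ->
  iter m (fock_F n i) (s l)
  = (qfact m * v ^ (- (inversions l N)%:Z)) *: s (add_all l).
Proof.
elim: m l => [|m IH] l lN mE.
  have nA y : ~~ A l y.
    apply/negP => ay; have := lN y ay => yN; move: mE; rewrite /above.
    by rewrite (bigD1 (Ordinal yN)) //= ay.
  rewrite /= /qfact /inversions big_ord0 big1 => [|y /negP]; last by case; exact/negP.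
  by rewrite mul1r oppr0 expr0z scale1r add_all_id.
rewrite iterSr (fock_F_widen lN).
have lin_iter j : exists f : {linear fock R -> fock R}, forall x, iter j (fock_F n i)
  x = f x.
  elim: j => [|j [f fE]]; first by exists idfun.
  by exists (fock_F n i \o f) => x; rewrite iterS fE.
have [f fE] := lin_iter m; rewrite fE raddf_sum /=.
have v0 := v_neq0 R.
(* In [height] minus the new [inversions] the removable rows above a cancel and the addable rows
   above a count twice: j is their number. *)
pose q (j : nat) : K := v ^ (j%:Z *+ 2 + 1 - m.+1%:Z).
transitivity (\sum_(a < N | A l a)
   (qfact m * v ^ (- (inversions l N)%:Z) * q (above (A l) a)) *: s (add_all l)).
  apply: eq_bigr => a ad; rewrite linearZ_LR -fE IH; first last.
  - have -> : above (A (add_node l a)) N = above (fun y => A l y && (y != a)) N.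
      by apply: eq_bigr => y _; rewrite (addable_i_add n_gt1 ad).
    have aN := lN _ ad; move: mE; rewrite /above (bigD1 (Ordinal aN)) //= ad.
    rewrite [in X in _ -> X](bigD1 (Ordinal aN)) //= eqxx andbF => [[<-]].
    by apply: eq_bigr => y; rewrite -val_eqE /= => ->; rewrite andbT.
  - by move=> y; rewrite (addable_i_add n_gt1 ad) => /andP[/lN].
  rewrite (add_all_add ad) scalerA; congr (_ *: _).
  apply: mulr_expz_collect => //; rewrite heightE.
  by have := inversions_add lN ad; rewrite mE; lia.
rewrite -scaler_suml -mulr_sumr (sum_above _ q) mE; congr (_ *: _).
have -> : qfact m.+1 = qfact m * qint m.+1 by exact: big_ord_recr.
exact: mulrAC.
Qed.

End FPower.

(** * Residue content and n-weight *)

Section Content.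
Variable n : nat.
Hypothesis n_gt1 : (1 < n)%N.
Local Notation res := (has_res n).

Definition rescount (r : int) (l : intpart) : int :=
  \sum_(a < size l) \sum_(b < row_len l a) (res r (b%:Z - a%:Z))%:Z.

Lemma rescount_widen r (l : intpart) N : (size l <= N)%N ->
  rescount r l = \sum_(a < N) \sum_(b < row_len l a) (res r (b%:Z - a%:Z))%:Z.
Proof.
move=> lN; rewrite -(subnKC lN) big_split_ord /= [X in _ + X]big1 ?addr0 // => a _.
have /eqP -> : row_len l (size l + a) == 0%N by rewrite row_len_eq0 leq_addr.
by rewrite big_ord0.
Qed.

Lemma res_mod r r' c : (r = r' %[mod n%:Z])%Z -> res r c = res r' c.
Proof. by rewrite /has_res => ->. Qed.

Lemma rescount_mod r r' l : (r = r' %[mod n%:Z])%Z -> rescount r l = rescount r' l.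
Proof. by move=> h; do 2 (apply: eq_bigr => ? _); rewrite (res_mod _ h). Qed.

Lemma sum_res_diff (r c : int) m :
  \sum_(b < m) (res r (b%:Z + c))%:Z - \sum_(b < m) (res (r + 1) (b%:Z + c))%:Z
  = (res (r + 1) (m%:Z + c))%:Z - (res (r + 1) c)%:Z.
Proof.
elim: m => [|m IH]; first by rewrite !big_ord0 subrr add0r subrr.
rewrite !big_ord_recr /= -(res_shift n r _ 1).
have -> : m.+1%:Z + c = m%:Z + c + 1 by lia.
by rewrite opprD addrACA IH addrC subrKA.
Qed.

Lemma rescount_diff r (l : intpart) N : (size l <= N)%N ->
  rescount r l - rescount (r + 1) l
  = \sum_(a < N) ((res (r + 1) (beta l a))%:Z - (res (r + 1) (- a%:Z))%:Z).
Proof.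
move=> lN; rewrite !(rescount_widen _ lN) -sumrB; apply: eq_bigr => a _.
exact: sum_res_diff.
Qed.

(** By [rescount_diff] the right-hand side is the number of beads of runner c among the first
    [size l] rows, minus that of the positions 0, -1, ... of the same range. The nonpositive beads
    occur in both and cancel. *)
Lemma chargeE (l : intpart) (c : nat) : charge n l c = rescount (c%:Z - 1) l -
  rescount c%:Z l.
Proof.
have := @rescount_diff (c%:Z - 1) l _ (leqnn _); rewrite subrK => ->;
  rewrite sumrB /charge.
have sum1 N (P : pred 'I_N) : #|[set k : 'I_N | P k]|%:Z = \sum_(k < N) (P k)%:Z.
  rewrite cardsE -sum1_card (big_morph Posz PoszD (erefl _)) /= big_mkcond.
  by apply: eq_bigr => k _; rewrite unfold_in; case: (P k).
rewrite !sum1 /=.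
have -> : \sum_(a < size l) (res c (beta l a))%:Z
  = \sum_(k < size l) ((0 < beta l k) && res c (beta l k))%:Z
    + \sum_(k < size l) ((beta l k <= 0) && res c (beta l k))%:Z.
  rewrite -big_split; apply: eq_bigr => k _ /=; rewrite ltNge.
  by case: (beta l k <= 0); rewrite ?addr0 ?add0r.
have -> : \sum_(a < size l) (res c (- a%:Z))%:Z
  = \sum_(k < size l) (~~ bead l (- k%:Z) && res c (- k%:Z))%:Z
    + \sum_(k < size l) (bead l (- k%:Z) && res c (- k%:Z))%:Z.
  rewrite -big_split; apply: eq_bigr => k _ /=.
  by case: (bead _ _); rewrite ?addr0 ?add0r.
suff -> : \sum_(k < size l) ((beta l k <= 0) && res c (beta l k))%:Z
  = \sum_(k < size l) (bead l (- k%:Z) && res c (- k%:Z))%:Z.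
  by rewrite opprD addrACA subrr addr0.
transitivity (\sum_(k < size l) \sum_(j < size l)
    ((beta l k == - j%:Z) && res c (- j%:Z))%:Z).
  apply: eq_bigr => k _.
  have ub : - (size l)%:Z < beta l k by have := ltn_ord k; rewrite /beta; lia.
  case: (lerP (beta l k) 0) => bk.
    have jP : (`|beta l k| < size l)%N by lia.
    have jE : - (Ordinal jP : nat)%:Z = beta l k by rewrite /=; lia.
    rewrite (bigD1 (Ordinal jP)) //= jE eqxx big1 ?addr0 // => j.
    rewrite -val_eqE /= => jk; suff -> : beta l k == - j%:Z = false by [].
    by apply/negbTE; lia.
  rewrite big1 // => j _; suff -> : beta l k == - j%:Z = false by [].
  by apply/negbTE; lia.
rewrite exchange_big /=; apply: eq_bigr => j _.
have bE : bead l (- j%:Z) = [exists k : 'I_(size l), beta l k == - j%:Z].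
  by rewrite /bead lerN2 lez_nat [(size l <= j)%N]leqNgt ltn_ord orbF.
rewrite bE; case: existsP => [[k /eqP kE]|h] /=.
  rewrite (bigD1 k) //= kE eqxx /= big1 ?addr0 // => k' /eqP kk.
  case: eqP => // kE'; case: kk; apply/val_inj/(@beta_inj l).
  by rewrite kE.
by rewrite big1 // => k _; case: eqP => // kE; case: h; exists k; rewrite kE.
Qed.

Definition nadd i (l : intpart) : nat := above (addable_i n i l) (size l).+1.
Definition nrem i (l : intpart) : nat := above (removable_i n i l) (size l).+1.

(** If row a is longer than row a+1, the removable node of the former and the addable node of the
    latter are i-nodes according to the residues of the two beta-numbers. If the lengths agree,
    neither node exists, and the residue terms cancel because the beta-numbers differ by one. *)
Lemma signature_telescope (i : nat) l N :
  \sum_(a < N) ((removable_i n i l a)%:Z - (addable_i n i l a)%:Z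
    - (res (i%:Z + 1) (beta l a))%:Z + (res i (beta l a))%:Z)
  = (addable_i n i l N)%:Z - (res i (beta l N))%:Z.
Proof.
elim: N => [|N IH]; first by rewrite big_ord0 addable_iE /= subrr.
rewrite big_ord_recr [LHS]/= {}IH removable_iE //.
have aE : addable l N.+1 = (row_len l N.+1 < row_len l N)%N by [].
rewrite [addable_i n i l N.+1]addable_iE /removable aE.
have := row_len_sorted l (leqnSn N); rewrite leq_eqVlt => /predU1P[e|-> /=].
  rewrite e ltnn /= add0r; have -> : beta l N = beta l N.+1 + 1 by rewrite /beta e; lia.
  by rewrite res_shift; lia.
by rewrite -[res i (_ - 1)](res_shift n _ _ 1) subrK; lia.
Qed.

(** Up to sign, the i-th coroot of affine sl_n evaluated on the weight Lambda_0 - sum_r c_r alpha_r,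
    where c_r is the number of cells of residue r. *)
Lemma nrem_sub_nadd (i : nat) l : (nrem i l)%:Z - (nadd i l)%:Z
  = rescount i l *+ 2 - rescount (i%:Z - 1) l - rescount (i%:Z + 1) l - (res i 0)%:Z.
Proof.
set N := (size l).+1; have lN : (size l <= N)%N by [].
pose B r : int := \sum_(a < N) (res r (beta l a))%:Z.
pose Z r : int := \sum_(a < N) (res r (- a%:Z))%:Z.
have h r : rescount r l - rescount (r + 1) l = B (r + 1) - Z (r + 1).
  by rewrite (rescount_diff r lN) sumrB.
have h1 := h i%:Z; have := h (i%:Z - 1); rewrite subrK => h2.
have e : Z (i%:Z + 1) - Z i%:Z = (res i (- N%:Z))%:Z - (res i 0)%:Z.
  rewrite /Z; elim: N {lN B Z h h1 h2} => [|N IH]; first by rewrite !big_ord0 !subrr.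
  rewrite !big_ord_recr /= -[res (i%:Z + 1) _](res_shift n _ _ (-1)) addrK.
  have -> : - N.+1%:Z = - N%:Z - 1 by lia.
  by rewrite opprD addrACA IH addrC subrKA.
have : (nrem i l)%:Z - (nadd i l)%:Z - B (i%:Z + 1) + B i%:Z = - (res i (- N%:Z))%:Z.
  have above_int P : (above P N)%:Z = \sum_(a < N) (P a)%:Z.
    by rewrite /above (big_morph Posz PoszD (erefl _)).
  rewrite /nrem /nadd !above_int -!sumrB -big_split signature_telescope.
  have /eqP rN : row_len l N == 0%N by rewrite row_len_eq0.
  have -> : addable_i n i l N = false by apply/negP => /addable_i_size; rewrite ltnn.
  by rewrite /beta rN !sub0r.
by rewrite mulr2n; lia.
Qed.

End Content.

Section Weight.
Variable n : nat.
Hypothesis n_gt1 : (1 < n)%N.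
Local Notation res := (has_res n).
Local Notation rescount := (rescount n).

Let n_gt0 : (0 < n)%N := ltnW n_gt1.

Lemma res_nat (c x : nat) : (c < n)%N -> res c x = (x %% n == c)%N.
Proof. by move=> cn; rewrite /has_res !modz_nat eqz_nat (modn_small cn). Qed.

Lemma res_periodic r (c : int) (M : nat) : res r (c + (M * n)%N%:Z) = res r c.
Proof. by rewrite /has_res PoszM addrC modzMDl. Qed.

(* The beta-numbers of the first N rows, shifted so that the empty partition
   gives 0, ..., N - 1. *)
Definition hook (N : nat) (l : intpart) (a : nat) : nat :=
  (row_len l a + (N - a.+1))%N.

Definition hooks (N : nat) (l : intpart) : seq nat := [seq hook N l a | a <- iota 0 N].

Lemma hook_beta N l a : (a < N)%N -> (hook N l a)%:Z = beta l a + N%:Z - 1.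
Proof. by rewrite /hook /beta; lia. Qed.

Lemma hooks_uniq N l : uniq (hooks N l).
Proof.
rewrite map_inj_in_uniq ?iota_uniq // => a b; rewrite !mem_iota !add0n /= => aN bN e.
by apply: (@beta_inj l); have := hook_beta l aN; have := hook_beta l bN; lia.
Qed.

Lemma mem_hooks (N : nat) (l : intpart) x : (size l <= N)%N ->
  (x \in hooks N l) = bead l (x%:Z + 1 - N%:Z).
Proof.
move=> lN; apply/mapP/beadP => [[a]|[k kE]].
  by rewrite mem_iota add0n /= => aN ->; exists a; rewrite hook_beta //; lia.
have kN : (k < N)%N.
  rewrite ltnNge; apply/negP => Nk; move: kE.
  have /eqP rk : row_len l k == 0%N by rewrite row_len_eq0 (leq_trans lN).
  by rewrite /beta rk; lia.
by exists k; rewrite ?mem_iota //; have := hook_beta l kN; lia.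
Qed.

(** A cell of row a is a unit move of bead a. When n divides N, its residue is that of the position
    reached, so [steps] counts the cells of residue r swept by a bead moving from 0 to x. *)
Definition steps (r : int) (x : nat) : int := \sum_(y < x) (res r (y%:Z + 1))%:Z.

Lemma stepsS r x : steps r x.+1 = steps r x + (res r (x%:Z + 1))%:Z.
Proof. by rewrite /steps big_ord_recr. Qed.

Lemma rescount_hooks r (l : intpart) N : (size l <= N)%N -> (n %| N)%N ->
  rescount r l = \sum_(x <- hooks N l) steps r x - \sum_(x < N) steps r x.
Proof.
move=> lN /dvdnP[M NE]; rewrite (rescount_widen n r lN) big_map.
have -> : \sum_(x < N) steps r x = \sum_(a < N) steps r (N - a.+1)%N.
  by rewrite (reindex_inj rev_ord_inj).
rewrite -[X in iota 0 X](subn0 N) -/(index_iota 0 N) big_mkord -sumrB.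
apply: eq_bigr => a _; rewrite /hook; elim: (row_len l a) => [|k IH].
  by rewrite add0n subrr big_ord0.
have e : res r (k%:Z - a%:Z) = res r ((k + (N - a.+1))%N%:Z + 1).
  rewrite -(res_periodic r (k%:Z - a%:Z) M) -NE; congr (res r _).
  by have := ltn_ord a; lia.
by rewrite big_ord_recr IH addSn stepsS addrAC /= e.
Qed.

Lemma steps_diff r x : steps r x - steps (r + 1) x = (res r x)%:Z - (res r 0)%:Z.
Proof. by rewrite /steps sum_res_diff // -(res_shift n r 0 1) add0r res_shift. Qed.

Lemma steps0 x : steps 0 x = (x %/ n)%N%:Z.
Proof.
elim: x => [|x IH]; first by rewrite /steps big_ord0 div0n.
rewrite stepsS IH; have -> : x%:Z + 1 = x.+1%:Z by lia.
rewrite (@res_nat 0 _ n_gt0) -PoszD; congr Posz.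
by have := divnS x n_gt0; rewrite /dvdn addnC.
Qed.

Lemma steps_period r x : steps r (x + n)%N = steps r x + 1.
Proof.
elim: x => [|x IH]; last first.
  have -> : steps r (x.+1 + n)%N = steps r (x + n)%N + (res r ((x + n)%N%:Z + 1))%:Z.
    exact: stepsS.
  have -> : (x + n)%N%:Z + 1 = x%:Z + 1 + (1 * n)%N%:Z by lia.
  by rewrite stepsS IH res_periodic addrAC.
rewrite {2}/steps big_ord0 add0r add0n.
have step q : steps q n = steps (q + 1) n.
  have := steps_diff q n; have := res_periodic q 0 1; rewrite mul1n add0r => ->.
  by rewrite subrr => /eqP; rewrite subr_eq0 => /eqP.
have mult (k : nat) q : steps q n = steps (q + k%:Z) n.
  elim: k q => [|k IH] q; first by rewrite addr0.
  by rewrite IH step -addrA; congr (steps _ n); lia.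
case: r => k; last by rewrite (mult k.+1) NegzE addNr steps0 divnn n_gt0.
by rewrite -[Posz k]add0r -mult steps0 divnn n_gt0.
Qed.

Lemma rescount_slide (l m : intpart) r : slide n l m -> rescount r l = rescount r m + 1.
Proof.
case=> x [bx nbx bm].
(* A multiple of n, as [rescount_hooks] requires, that bounds both sizes. *)
pose N := ((size l + size m + n) * n)%N.
have sN : (size l + size m + n <= N)%N by rewrite leq_pmulr.
have lN : (size l <= N)%N by lia.
have mN : (size m <= N)%N by lia.
have nN : (n %| N)%N by rewrite dvdn_mull.
rewrite !(rescount_hooks r _ nN) // addrAC; congr (_ - _).
have xl : - (size l)%:Z < x - n%:Z.
  by move: nbx; rewrite /bead negb_or -ltNge => /andP[].
have [z zE] : exists z : nat, (z + n)%N%:Z = x + N%:Z - 1.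
  by exists (absz (x - n%:Z + N%:Z - 1)%R); lia.
have zl : (z + n)%N \in hooks N l by rewrite mem_hooks // zE addrNK addrK.
have zm : perm_eq (hooks N m) (z :: rem (z + n)%N (hooks N l)).
  have un : uniq (z :: rem (z + n)%N (hooks N l)).
    rewrite /= rem_uniq ?hooks_uniq // andbT.
    rewrite mem_rem_uniq ?hooks_uniq // inE mem_hooks // negb_and.
    have -> : z%:Z + 1 - N%:Z = x - n%:Z by lia.
    by rewrite nbx orbT.
  apply: uniq_perm un _ => [|y]; first exact: hooks_uniq.
  rewrite inE mem_rem_uniq ?hooks_uniq // inE /= !mem_hooks // bm andbC.
  have -> : (y%:Z + 1 - N%:Z == x - n%:Z) = (y == z) by lia.
  have -> // : (y%:Z + 1 - N%:Z != x) = (y != (z + n)%N) by lia.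
rewrite (perm_big _ zm) (perm_big _ (perm_to_rem zl)) !big_cons steps_period.
by rewrite addrAC.
Qed.

Lemma sum_res (c : int) : \sum_(r < n) (res r c)%:Z = 1.
Proof.
have n0 : n%:Z != 0 by lia.
have kP : (`|(c %% n%:Z)%Z| < n)%N.
  by have := ltz_mod c n0; have := modz_ge0 c n0; lia.
have resk (r : 'I_n) : res r c = (r == Ordinal kP).
  rewrite /has_res modz_nat (modn_small (ltn_ord r)) -val_eqE /= eq_sym -eqz_nat.
  by rewrite gez0_abs ?modz_ge0.
rewrite (bigD1 (Ordinal kP)) // resk eqxx big1 ?addr0 // => r rk.
by rewrite resk (negPf rk).
Qed.

Lemma sum_rc (l : intpart) : (psize l)%:Z = \sum_(r < n) rescount r l.
Proof.
rewrite exchange_big (psizeE (leqnn _)) (big_morph Posz PoszD (erefl _)) /=.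
apply: eq_bigr => a _; rewrite exchange_big /=.
rewrite -[in LHS](card_ord (row_len l a)) -sum1_card (big_morph Posz PoszD (erefl _)).
by apply: eq_bigr => b _; rewrite sum_res.
Qed.

(** Each slide removes one cell of every residue; the number of slides is then identified with w by
    comparing sizes. *)
Lemma P0_rc (t l : intpart) w : P0 n t w l -> forall r, rescount r l = rescount r t +
  w%:Z.
Proof.
case=> [[sl _]] szl.
have [j jE] : exists j : nat, forall r, rescount r l = rescount r t + j%:Z.
  elim: sl => [x y h|x|x y z _ [j jE] _ [k kE]].
  - by exists 1%N => r; rewrite (rescount_slide _ h).
  - by exists 0%N => r; rewrite addr0.
  - by exists (k + j)%N => r; rewrite jE kE PoszD addrA.
suff -> : w = j by [].
have := sum_rc l; rewrite szl PoszD sum_rc.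
under [X in _ = X]eq_bigr => r _ do rewrite jE.
rewrite big_split /= => /addrI; rewrite sumr_const card_ord PoszM -mulr_natl natz.
have n0 : n%:Z != 0 by lia.
by move/(mulfI n0) => [].
Qed.

End Weight.

(** Once sorted, the entry of index j is at least j. On a runner this compares the beads with their
    lowest configuration. *)
Lemma bin2_le_sumn (s : seq nat) : uniq s -> ('C(size s, 2) <= sumn s)%N.
Proof.
move=> us; have ps : perm_eq (sort leq s) s by rewrite perm_sort.
rewrite -(perm_size ps) -(perm_sumn ps); set t := sort leq s.
have st : sorted ltn t by rewrite ltn_sorted_uniq_leq sort_uniq us sort_sorted //;
  exact: leq_total.
rewrite -bin2_sum sumnE [X in (_ <= X)%N](big_nth 0%N) !big_mkord;
  apply: leq_sum => i _.
elim: {i}(i : nat) (ltn_ord i) => // i IH h; apply: (leq_ltn_trans (IH (ltnW h))).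
by move/(sortedP 0%N)/(_ i h): st.
Qed.

(** Closure under predecessors makes [s] an initial segment of the natural numbers. *)
Lemma bin2_sumn_closed (s : seq nat) : uniq s ->
  (forall x, x.+1 \in s -> x \in s) -> sumn s = 'C(size s, 2).
Proof.
move=> us cl; have down x k : (x + k)%N \in s -> x \in s.
  by elim: k => [|k IH]; rewrite ?addn0 // addnS => /cl.
have ps : perm_eq s (iota 0 (size s)).
  rewrite uniq_perm ?iota_uniq //; apply: (uniq_min_size us _ _).2.
    move=> x xs; rewrite mem_iota /= add0n -(size_iota 0 x.+1).
    apply: uniq_leq_size (iota_uniq _ _) _ => y; rewrite mem_iota add0n ltnS => yx.
    by apply: (down _ (x - y)%N); rewrite subnKC.
  by rewrite size_iota.
by rewrite (perm_sumn ps) sumnE -bin2_sum /index_iota subn0.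
Qed.

Section Weight.
Variable n : nat.
Hypothesis n_gt1 : (1 < n)%N.
Local Notation res := (has_res n).
Local Notation rescount := (rescount n).

Let n_gt0 : (0 < n)%N := ltnW n_gt1.

(* Twice the n-weight, as a function of the numbers of cells of each residue. *)
Definition weight2 (l : intpart) : int :=
  rescount 0 l *+ 2 - \sum_(c < n) (rescount c%:Z l - rescount (c%:Z + 1) l) ^+ 2.

Definition runner (c : nat) (s : seq nat) : seq nat :=
  [seq x %/ n | x <- s & x %% n == c]%N.

Lemma runner_uniq c s : uniq s -> uniq (runner c s).
Proof.
move=> us; rewrite map_inj_in_uniq ?filter_uniq // => x y.
rewrite !mem_filter => /andP[/eqP xc _] /andP[/eqP yc _] e.
by rewrite (divn_eq x n) (divn_eq y n) e xc yc.
Qed.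

Lemma mem_runner c s q : (c < n)%N -> (q \in runner c s) = ((q * n + c)%N \in s).
Proof.
move=> cn; apply/mapP/idP => [[x]|h].
  by rewrite mem_filter => /andP[/eqP <- xs] ->; rewrite -divn_eq.
exists (q * n + c)%N; first by rewrite mem_filter modnMDl modn_small // eqxx.
by rewrite divnMDl // divn_small // addn0.
Qed.

Lemma size_runner c s :
  (size (runner c s))%:Z = \sum_(x <- s) ((x %% n == c)%N : nat)%:Z.
Proof.
rewrite size_map size_filter; elim: s => [|x s IH]; first by rewrite big_nil.
by rewrite big_cons -IH /= PoszD.
Qed.

Lemma sumn_runners s : (\sum_(x <- s) x %/ n = \sum_(c < n) sumn (runner c s))%N.
Proof.
rewrite (partition_big (fun x => Ordinal (ltn_pmod x n_gt0)) xpredT) //=.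
by apply: eq_bigr => c _; rewrite sumnE big_map big_filter.
Qed.

Lemma size_runner_iota (c : 'I_n) M : size (runner c (iota 0 (M * n)%N)) = M.
Proof.
have mem q : (q \in runner c (iota 0 (M * n)%N)) = (q \in iota 0 M).
  rewrite mem_runner // !mem_iota /= !add0n; apply/idP/idP => h; last first.
    by apply: (@leq_trans (q.+1 * n)); rewrite ?leq_mul // mulSn addnC ltn_add2r.
  by rewrite -(ltn_pmul2r n_gt0); apply: leq_ltn_trans h; rewrite leq_addr.
rewrite -[RHS](size_iota 0); apply/perm_size/uniq_perm => //.
  exact/runner_uniq/iota_uniq.
exact: iota_uniq.
Qed.

(** On each runner, the sum of the bead heights minus its minimum for that number of beads. The bead
    numbers minus M are the differences of residue counts squared in [weight2], and the residue 0
    count is the sum of all heights, up to a constant. *)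
Lemma weight2E (l : intpart) M : (size l <= M * n)%N ->
  weight2 l = (\sum_(c < n) ((sumn (runner c (hooks (M * n) l)))%:Z
     - 'C(size (runner c (hooks (M * n) l)), 2)%:Z)) *+ 2.
Proof.
move=> lN; set N := (M * n)%N in lN *; set X := hooks _ l.
have nN : (n %| N)%N by exact: dvdn_mull.
pose u (c : 'I_n) := size (runner c X).
have rcE r : rescount r l = \sum_(x <- X) steps n r x - \sum_(x <- iota 0 N) steps n r
  x.
  by rewrite (rescount_hooks n_gt1 r lN nN) -[X in iota 0 X]subn0 big_mkord.
have szE s (c : 'I_n) : (size (runner c s))%:Z
    = \sum_(x <- s) (steps n c x - steps n (c%:Z + 1) x + (res c 0)%:Z).
  rewrite size_runner; apply: eq_bigr => x _.
  by rewrite steps_diff // addrNK res_nat.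
have uE (c : 'I_n) : rescount c%:Z l - rescount (c%:Z + 1) l = (u c)%:Z - M%:Z.
  rewrite -[in RHS](size_runner_iota c M) !szE !big_split /= !sumrN !rcE.
  have -> : \sum_(x <- X) (res c 0)%:Z = \sum_(x <- iota 0 N) (res c 0)%:Z.
    by rewrite big_map.
  rewrite -/N; ring.
have sum0 : \sum_(c < n) ((u c)%:Z - M%:Z) = 0.
  rewrite sumrB sumr_const card_ord; apply/eqP; rewrite subr_eq0; apply/eqP.
  under eq_bigr => c _ do rewrite /u size_runner.
  rewrite exchange_big /=.
  rewrite (eq_bigr (fun=> 1)) => [|x _].
    by rewrite big_map -[X in iota 0 X]subn0 big_mkord sumr_const card_ord -mulr_natr
      natz; lia.
  rewrite (bigD1 (Ordinal (ltn_pmod x n_gt0))) //= eqxx big1 ?addr0 // => c.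
  by rewrite -val_eqE eq_sym /= => /negPf ->.
have rc0 : rescount 0 l = \sum_(c < n) ((sumn (runner c X))%:Z - 'C(M, 2)%:Z).
  have sE t : \sum_(x <- t) steps n 0 x = \sum_(c < n) (sumn (runner c t))%:Z.
    rewrite -(big_morph Posz PoszD (erefl _)) -sumn_runners.
    by rewrite (big_morph Posz PoszD (erefl _)); apply: eq_bigr => x _; exact: steps0.
  rewrite rcE !sE.
  rewrite -sumrB; apply: eq_bigr => c _;
    rewrite (@bin2_sumn_closed (runner c (iota 0 N))).
  - by rewrite size_runner_iota.
  - exact/runner_uniq/iota_uniq.
  - move=> x; rewrite !mem_runner // !mem_iota /= !add0n mulSn; lia.
have binE m : 'C(m, 2)%:Z *+ 2 = m%:Z ^+ 2 - m%:Z.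
  have : ('C(m, 2) * 2 = m * m.-1)%N by rewrite bin2 muln2 halfK; case: m => // m;
    rewrite /= oddM /= andNb subn0.
  by case: m => [|m] //= h; rewrite -mulr_natr -PoszM h !PoszM; ring.
rewrite /weight2 rc0 -!sumrMnl -!sumrB.
(* The two sides differ by a multiple of the sum of the [u c - M], which is zero. *)
have z : \sum_(c < n) ((u c)%:Z - M%:Z) * (1 - M%:Z *+ 2) = 0.
  by rewrite -mulr_suml sum0 mul0r.
rewrite -[LHS]addr0 -[X in _ + X]z -big_split /=.
apply: eq_bigr => c _; rewrite uE !mulrnBl !binE -/(u c); ring.
Qed.

Lemma weight2_ge0 (l : intpart) : 0 <= weight2 l.
Proof.
rewrite (@weight2E l (size l)) ?leq_pmulr // mulrn_wge0 // sumr_ge0 // => c _.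
by rewrite subr_ge0 lez_nat bin2_le_sumn // runner_uniq // (hooks_uniq n_gt1).
Qed.

Lemma weight2_core (l : intpart) : is_core n l -> weight2 l = 0.
Proof.
move=> co; have lN : (size l <= size l * n)%N by rewrite leq_pmulr.
rewrite (weight2E lN) big1 ?mul0rn // => c _; rewrite bin2_sumn_closed ?subrr //.
  exact: runner_uniq (hooks_uniq n_gt1 _ _).
move=> x; rewrite !mem_runner // !(mem_hooks n_gt1) // => /co.
by congr (bead _ _); lia.
Qed.

(** Adding w to all residue counts leaves their differences, hence the quadratic term, unchanged. *)
Lemma P0_weight2 (t l : intpart) w : is_core n t -> P0 n t w l ->
  weight2 l = w%:Z *+ 2.
Proof.
move=> /weight2_core t0 /(P0_rc n_gt1) h; rewrite -[RHS]add0r -t0 /weight2 h.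
rewrite mulrnDl addrAC; congr (_ - _ + _); apply: eq_bigr => c _.
by rewrite !h; congr (_ ^+ 2); ring.
Qed.

End Weight.

(** * Scopes' bijection, signatures and the weight bound *)

Section ScopesPi.
Variables (n i : nat).
Hypothesis n_gt1 : (1 < n)%N.
Local Notation res := (has_res n).
Local Notation rescount := (rescount n).
Local Notation A := (addable_i n i).
Local Notation Rm := (removable_i n i).
Local Notation spi := (scopes_pi n i).

Lemma removable_row l a : Rm l a -> (0 < row_len l a)%N.
Proof. by case/andP => h _; exact: leq_ltn_trans h. Qed.

Lemma row_len_pi l a : row_len (spi l) a = (row_len l a - Rm l a)%N.
Proof.
have E : spi l = mkpart (mkseq (fun a => row_len l a - Rm l a)%N (size l)).
  apply/val_inj; rewrite /mkpart val_insubd /= ifT //.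
  exact: scopes_pi_subproof.
rewrite E row_len_mkpart_mkseq => [|b _].
  case: ltnP => // la; have /eqP -> : row_len l a == 0%N by rewrite row_len_eq0.
  by rewrite sub0n.
have := row_len_sorted l (leqnSn b); have := @removable_row l b.
case: (boolP (Rm l b)) => [/andP[rb _]|_] /=; last by lia.
by move: rb; rewrite /removable; lia.
Qed.

(** The removed nodes become addable again; any other node whose addability changes is adjacent to a
    removed one and has another residue. *)
Lemma addable_i_pi l y : A (spi l) y = A l y || Rm l y.
Proof.
rewrite !addable_iE (removable_iE i n_gt1) /beta row_len_pi.
case: (boolP (Rm l y)) => [ry|nry].
  have := removable_row ry; move: ry; rewrite (removable_iE i n_gt1) => /andP[ry r].
  rewrite ry r orbT /= => y0; have -> : (row_len l y - 1)%N%:Z - y%:Z = beta l y - 1.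
    by rewrite /beta; lia.
  rewrite r andbT /addable; case: y ry r y0 => [|z] //= ry r y0.
  rewrite !row_len_pi; have := row_len_sorted l (leqnSn z).
  have -> : Rm l z.+1 by rewrite (removable_iE i n_gt1) ry.
  case: (boolP (Rm l z)) => [/andP[+ _]|_]; last by lia.
  by rewrite /removable; lia.
rewrite -(removable_iE i n_gt1) (negPf nry) orbF subn0 -/(beta l y).
rewrite /addable; case: y nry => [|z] //= nry.
rewrite !row_len_pi (negPf nry) subn0.
case: (boolP (Rm l z)) => [|_]; last by rewrite subn0.
rewrite (removable_iE i n_gt1) /removable => /andP[rz r]; rewrite rz /=.
case: (ltnP (row_len l z.+1) (row_len l z - 1)) => //= h.
apply/esym/negbTE/negP => /(res_succ n_gt1)/negP; apply.
by move: r; congr (res _ _); rewrite /beta; lia.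
Qed.

Lemma removable_i_add_all l y : Rm (add_all n i l) y = A l y || Rm l y.
Proof.
rewrite !(removable_iE i n_gt1) addable_iE /removable /beta !row_len_add_all //.
case: (boolP (A l y)) => [ay|nay].
  rewrite -addable_iE ay /= PoszD; have := ay; rewrite addable_iE => /andP[_ r].
  have -> : (row_len l y)%:Z + 1 - y%:Z - 1 = beta l y by rewrite /beta; lia.
  rewrite r andbT; have := row_len_sorted l (leqnSn y).
  by case: (boolP (A l y.+1)) => [/andP[+ _]|_]; rewrite /addable /=; lia.
rewrite -addable_iE (negPf nay) /= addn0 -/(beta l y).
case: (boolP (A l y.+1)) => [|_]; last by rewrite addn0.
rewrite addable_iE /addable /= => /andP[rz r]; rewrite rz /=.
case: (ltnP (row_len l y.+1 + 1) (row_len l y)) => //= h.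
apply/esym/negbTE/negP => h'; have /negP := res_succ n_gt1 r; apply.
by move: h'; congr (res _ _); rewrite /beta; lia.
Qed.

Lemma add_all_pi l : (forall y, ~~ A l y) -> add_all n i (spi l) = l.
Proof.
move=> h; apply: row_len_ext => y;
  rewrite row_len_add_all // addable_i_pi (negPf (h y)) /=.
by rewrite row_len_pi; have := @removable_row l y; case: (Rm l y); lia.
Qed.

Lemma pi_add_all l : (forall y, ~~ Rm l y) -> spi (add_all n i l) = l.
Proof.
move=> h; apply: row_len_ext => y; rewrite row_len_pi removable_i_add_all.
by rewrite row_len_add_all // (negPf (h y)) orbF addnK.
Qed.

(** [beta l a] is the content of the cell appended to row a. *)
Lemma rescount_rows r (l m : intpart) (P : pred nat) N : (size l <= N)%N -> (size m <=
  N)%N ->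
  (forall a, (P a : nat) = 0%N \/ res i (beta l a)) ->
  (forall a, row_len m a = (row_len l a + P a)%N) ->
  rescount r m = rescount r l + (above P N)%:Z * (res r i)%:Z.
Proof.
move=> lN mN h e; rewrite !(rescount_widen n r (N := N)) // /above.
rewrite (big_morph Posz PoszD (erefl _)) mulr_suml -big_split /=.
apply: eq_bigr => a _; rewrite e; case: (h a) => [->|].
  by rewrite addn0 mul0r addr0.
case: (P a); rewrite ?mul0r ?addr0 ?addn0 // mul1r addn1 big_ord_recr /= /beta.
by rewrite /has_res => /eqP ->.
Qed.

Lemma rescount_add r l a : A l a -> rescount r (add_node l a) = rescount r l + (res r
  i)%:Z.
Proof.
move=> ad; have al : addable l a by case/andP: ad.
rewrite (@rescount_rows r l _ (pred1 a) (size l + size (add_node l a) + a.+1)) //;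
  try lia.
- rewrite /above (bigD1 (Ordinal (_ : (a < size l + size (add_node l a) + a.+1)%N)))
  //=; first by lia.
  move=> aN; rewrite eqxx big1 ?addn0 ?mul1r // => y; rewrite -val_eqE /=.
  by move/negPf->.
- by move=> y /=; case: (eqVneq y a) => [->|_]; [right; case/andP: ad | left].
- by move=> y; rewrite row_len_add // addnC.
Qed.

Lemma rescount_pi r l : rescount r (spi l) = rescount r l - (nrem n i l)%:Z * (res r
  i)%:Z.
Proof.
pose N := (size l + size (spi l) + 1)%N.
rewrite (@rescount_rows r (spi l) l (Rm l) N) ?addrK; try (rewrite /N; lia).
- suff -> : nrem n i l = above (Rm l) N by rewrite addrK.
  rewrite /nrem /above (big_ord_widen N (fun y => Rm l y : nat)) ?big_mkcond;
    last by rewrite /N; lia.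
  apply: eq_bigr => y _; case: ifP => // /negbT; rewrite -leqNgt => h.
  by case: (boolP (Rm l y)) => // /removable_i_size; lia.
- move=> a; case: (boolP (Rm l a)) => ra; [right|by left].
  have : A (spi l) a by rewrite addable_i_pi ra orbT.
  by case/andP.
- by move=> a; rewrite row_len_pi; have := @removable_row l a; case: (Rm l a); lia.
Qed.

Lemma sum_shift (f : int -> int) : (forall r, f (r + n%:Z) = f r) ->
  \sum_(c < n) f (c%:Z + 1) = \sum_(c < n) f c%:Z.
Proof.
move=> fP; have n0 : n = n.-1.+1 by lia.
rewrite n0 big_ord_recr big_ord_recl /= addrC; congr (_ + _).
  by rewrite -(fP 0) add0r; congr f; lia.
by apply: eq_bigr => c _; congr f; rewrite /bump /=; lia.
Qed.

Hypothesis i_lt_n : (i < n)%N.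

Lemma res_i_lt (c : nat) : (c < n)%N -> res c i = (c == i).
Proof.
by move=> cn; rewrite /has_res !modz_nat eqz_nat !modn_small // eq_sym.
Qed.

Lemma sum_pick (g : int -> int) : \sum_(c < n) g c%:Z * (res c%:Z i)%:Z = g i%:Z.
Proof.
rewrite (bigD1 (Ordinal i_lt_n)) //= res_i_lt // eqxx mulr1 big1 ?addr0 // => c.
by rewrite -val_eqE /= => ci; rewrite res_i_lt // (negPf ci) mulr0.
Qed.

(* Removing all the removable i-nodes lowers the n-weight by the product of the
   numbers of removable and addable i-nodes: hence signature_le_weight2. *)
Lemma weight2_pi l :
  weight2 n (spi l) = weight2 n l - ((nrem n i l * nadd n i l)%N%:Z) *+ 2.
Proof.
pose u r := rescount r l; pose e r : int := (res r i)%:Z; pose rho := (nrem n i l)%:Z.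
pose g r := u r - u (r + 1).
have uP r : u (r + n%:Z) = u r by apply: rescount_mod; rewrite modzDr.
have eP r : e (r + n%:Z) = e r by rewrite /e /has_res modzDr.
have nres r c : res r c -> res (r + 1) c = false.
  move=> h; apply/negbTE/negP; rewrite -(res_shift n r c 1) in h.
  by move=> /(res_succ n_gt1); rewrite h.
(* The two indicators are never both 1, as n > 1. *)
have e2 r : (e r - e (r + 1)) ^+ 2 = e r + e (r + 1).
  by rewrite /e; case: (boolP (res r i)) => [/nres ->|_]; case: (res _ _).
have pick2 f : (forall r, f (r + n%:Z) = f r) ->
    \sum_(c < n) f c%:Z * e (c%:Z + 1) = f (i%:Z - 1).
  move=> fP; rewrite -(sum_pick (fun c => f (c - 1))).
  rewrite -(sum_shift (f := fun c => f (c - 1) * e c)) => [|r]; last first.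
    by rewrite eP addrAC fP.
  by apply: eq_bigr => c _; rewrite addrK.
have gP r : g (r + n%:Z) = g r by rewrite /g addrAC !uP.
have s1 : \sum_(c < n) (e c%:Z + e (c%:Z + 1)) = 2.
  rewrite big_split /= (sum_shift eP).
  have -> : \sum_(c < n) e c%:Z = 1.
    by rewrite -[RHS](sum_pick (fun=> 1)); apply: eq_bigr => c _; rewrite mul1r.
  by [].
(* The cross term of the quadratic form is the expression in [nrem_sub_nadd], which brings in the
   signature. *)
have s2 : \sum_(c < n) g c%:Z * (e c%:Z - e (c%:Z + 1)) = u i *+ 2 - u (i%:Z - 1) - u
  (i%:Z + 1).
  rewrite (eq_bigr (fun c : 'I_n => g c%:Z * e c%:Z - g c%:Z * e (c%:Z + 1))) => [|c
    _]; last exact: mulrBr.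
  rewrite sumrB sum_pick (pick2 g gP) /g subrK; ring.
have := nrem_sub_nadd n_gt1 i l; rewrite -/(u i) -!/(u _) -/rho => sub.
have e0 : e 0 = (res i 0)%:Z.
  by rewrite /e /has_res eq_sym.
rewrite /weight2 !rescount_pi -/(e 0) -/(u 0) -/rho PoszM -/rho.
rewrite (eq_bigr (fun c : 'I_n => g c%:Z ^+ 2
   - rho * (g c%:Z * (e c%:Z - e (c%:Z + 1))) *+ 2
   + rho ^+ 2 * (e c%:Z + e (c%:Z + 1)))) => [|c _]; last first.
  by rewrite !rescount_pi -e2 /g /u /e -/rho; ring.
rewrite big_split sumrB /= sumrMnl -!mulr_sumr s1 s2 e0.
have -> : (nadd n i l)%:Z = rho - (u i *+ 2 - u (i%:Z - 1) - u (i%:Z + 1) - (res i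
  0)%:Z).
  by rewrite -sub; ring.
by rewrite /g; ring.
Qed.

Lemma rescount_weight2 l m : (forall r, rescount r l = rescount r m) -> weight2 n l =
  weight2 n m.
Proof. by move=> h; rewrite /weight2 h; under eq_bigr do rewrite !h. Qed.

(** Both sides are second differences of residue counts by [chargeE]. Runner n has residue 0, and
    the -1 in k_0 is the term [has_res n i 0] of [nrem_sub_nadd]. *)
Lemma scopes_kE (t : intpart) :
  scopes_k n t i = (nrem n i t)%:Z - (nadd n i t)%:Z.
Proof.
rewrite (nrem_sub_nadd n_gt1) /scopes_k !(chargeE n_gt1) /has_res.
have [->|i0] := eqVneq i 0%N.
  have -> : rescount n%:Z t = rescount 0 t by apply: rescount_mod; rewrite modzz mod0z.
  have -> : rescount (n%:Z - 1) t = rescount (0 - 1) t by apply: rescount_mod;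
    rewrite sub0r modzDl.
  rewrite eqxx subrr add0r /=; ring.
rewrite mod0z modz_nat modn_small // (negPf (_ : (0 != i%:Z))); last by lia.
by rewrite -addn1 PoszD addrK subr0; ring.
Qed.

Lemma nadd_eq0 l : nadd n i l = 0%N -> forall y, ~~ A l y.
Proof.
move=> h y; apply/negP => ay;
  have yl : (y < (size l).+1)%N by rewrite ltnS (addable_i_size ay).
by move: h; rewrite /nadd /above (bigD1 (Ordinal yl)) //= ay.
Qed.

Lemma nrem_eq0 l : nrem n i l = 0%N -> forall y, ~~ Rm l y.
Proof.
move=> h y; apply/negP => ay.
have yl : (y < (size l).+1)%N by rewrite ltnS ltnW // (removable_i_size ay).
by move: h; rewrite /nrem /above (bigD1 (Ordinal yl)) //= ay.
Qed.

Lemma signature_le_weight2 l : (nrem n i l * nadd n i l)%N%:Z *+ 2 <= weight2 n l.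
Proof. by have := weight2_ge0 n_gt1 (spi l); rewrite weight2_pi subr_ge0. Qed.

(** With r removable and s addable i-nodes, r s <= w <= r - s, which is impossible for s > 0. *)
Lemma P0_signature (t l : intpart) w : is_core n t -> w%:Z <= scopes_k n t i ->
  P0 n t w l -> nadd n i l = 0%N /\ (nrem n i l)%:Z = scopes_k n t i.
Proof.
move=> co wk lP; have wl := P0_weight2 n_gt1 co lP.
have sub : (nrem n i l)%:Z - (nadd n i l)%:Z = scopes_k n t i.
  rewrite scopes_kE !(nrem_sub_nadd n_gt1) !(P0_rc n_gt1 lP); ring.
have := signature_le_weight2 l; rewrite wl !mulr2n => sg; rewrite -sub in wk.
suff a0 : nadd n i l = 0%N by rewrite -sub a0 subr0.
by case: (nadd n i l) wk sg => // a wk; rewrite mulnS; lia.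
Qed.

(** Removing k cells of residue i lowers the signature difference from k to k - 2k = -k, and it
    keeps the weight because [l] has no addable i-node. The inequality of [P0_signature] then
    applies with the two kinds of nodes exchanged. *)
Lemma pi_block_signature (t l m : intpart) w : is_core n t ->
  w%:Z <= scopes_k n t i -> P0 n t w l -> (forall r, rescount r m = rescount r (spi
    l)) ->
  nrem n i m = 0%N /\ (nadd n i m)%:Z = scopes_k n t i.
Proof.
move=> co wk lP h; have [l0 lk] := P0_signature co wk lP.
have sub : (nadd n i m)%:Z - (nrem n i m)%:Z = scopes_k n t i.
  have e : (res (i%:Z - 1) i = false) * (res (i%:Z + 1) i = false) * (res i i).
    have ri : res i i by rewrite /has_res.
    split; [split|exact: ri]; apply/negbTE.
      by rewrite -(res_shift n _ _ 1) subrK; exact: res_succ.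
    by rewrite -(res_shift n _ _ (-1)) addrK; exact: res_pred.
  rewrite -lk -opprB (nrem_sub_nadd n_gt1) !h !rescount_pi !e mulr0 mulr1 subr0.
  have := nrem_sub_nadd n_gt1 i l; rewrite l0 subr0 => ->; ring.
have := signature_le_weight2 m; rewrite (rescount_weight2 h) weight2_pi l0 muln0 subr0.
rewrite (P0_weight2 n_gt1 co lP) !mulr2n => sg; rewrite -sub in wk.
suff a0 : nrem n i m = 0%N by rewrite -sub a0 subr0.
by case: (nrem n i m) wk sg => // a wk; rewrite mulSn; lia.
Qed.

End ScopesPi.

(** * Scalars *)

Section Scalars.
Variable R : realType.
Local Notation C := R[i].
Local Notation K := {fraction {poly R[i]}}.
Local Notation v := (v R).
Local Notation tofrac := (@FracField.tofrac _).
Local Notation "x %:F" := (tofrac x).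

Lemma fracE (x : K) : exists p, exists2 q : {poly C}, q != 0 & x = p%:F / q%:F.
Proof.
exists (\n_(repr x)), (\d_(repr x)); first exact: denom_ratioP.
by rewrite -[LHS]reprK pi_ratioE.
Qed.

Lemma eval_atD (t : K) p q : eval_at t (p + q) = eval_at t p + eval_at t q.
Proof. by rewrite /eval_at rmorphD hornerD. Qed.

Lemma eval_at1 (t : K) : eval_at t 1 = 1.
Proof. by rewrite /eval_at rmorph1 hornerC. Qed.

Lemma eval_atN (t : K) p : eval_at t (- p) = - eval_at t p.
Proof. by rewrite /eval_at rmorphN hornerN. Qed.

Lemma subst_vinv_is_zmod : zmod_morphism (@subst_vinv R).
Proof.
move=> x y; have [p [q q0 ->]] := fracE x; have [p' [q' q'0 ->]] := fracE y.
have F0 (z : {poly C}) : z != 0 -> z%:F != 0 by rewrite tofrac_eq0.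
rewrite -mulNr addf_div ?F0 // -rmorphN /= -!rmorphM /= -rmorphD /=.
rewrite !subst_vinvE ?mulf_neq0 // eval_atD !eval_atM eval_atN.
by rewrite -[in RHS]mulNr addf_div ?eval_vinv_neq0.
Qed.

Lemma subst_vinv_is_monoid : monoid_morphism (@subst_vinv R).
Proof.
split=> [|x y].
  rewrite -[X in subst_vinv X](divr1 1) -{1 2}tofrac1 subst_vinvE ?oner_neq0 //.
  by rewrite eval_at1 divr1.
have [p [q q0 ->]] := fracE x; have [p' [q' q'0 ->]] := fracE y.
rewrite mulf_div -!rmorphM /= !subst_vinvE ?mulf_neq0 // !eval_atM.
by rewrite mulf_div.
Qed.

HB.instance Definition _ :=
  GRing.isZmodMorphism.Build K K (@subst_vinv R) subst_vinv_is_zmod.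
HB.instance Definition _ :=
  GRing.isMonoidMorphism.Build K K (@subst_vinv R) subst_vinv_is_monoid.

Lemma subst_vinv_v : subst_vinv v = v^-1.
Proof.
rewrite -[X in subst_vinv X](divr1 v) -tofrac1 subst_vinvE ?oner_neq0 //.
by rewrite eval_at1 divr1 /eval_at map_polyX hornerX.
Qed.

Definition iev (t : K) : {rmorphism {poly int} -> K} :=
  horner_eval t \o map_poly intr.

Lemma int_evalE (t : K) : int_eval t = iev t.
Proof. by []. Qed.

Lemma iev_X t : iev t 'X = t.
Proof. by rewrite /= map_polyX /horner_eval hornerX. Qed.

Lemma iev_C t (c : int) : iev t c%:P = c%:~R.
Proof. by rewrite /= map_polyC /horner_eval hornerC. Qed.

Lemma subst_iev t p : subst_vinv (iev t p) = iev (subst_vinv t) p.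
Proof.
rewrite /= /horner_eval -horner_map -map_poly_comp; congr (_.[_]).
by apply: eq_map_poly => c; rewrite /= rmorph_int.
Qed.

Lemma iev_v p : iev v p = (map_poly (intr : int -> C) p)%:F.
Proof.
elim/poly_ind: p => [|p c IH]; first by rewrite !rmorph0.
rewrite rmorphD rmorphM iev_X iev_C IH rmorphD rmorphM /= map_polyX map_polyC.
by rewrite rmorphD rmorphM /= !rmorph_int.
Qed.

Lemma iev_v_inj : injective (iev v).
Proof.
move=> p q; rewrite !iev_v => /eqP; rewrite tofrac_eq => /eqP.
by apply: map_inj_poly; [exact: intr_inj|exact: mulr0z].
Qed.

Lemma subst_vinvV : subst_vinv v^-1 = v.
Proof. by rewrite fmorphV /= subst_vinv_v invrK. Qed.

Lemma iev_vinv_inj : injective (iev v^-1).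
Proof.
by move=> p q /(congr1 (@subst_vinv R)); rewrite !subst_iev subst_vinvV => /iev_v_inj.
Qed.

Lemma iev_oppvinv_inj : injective (iev (- v^-1)).
Proof.
have e p : iev (- v^-1) p = iev v^-1 (p \Po - 'X).
  elim/poly_ind: p => [|p c IH]; first by rewrite comp_poly0 !rmorph0.
  rewrite comp_polyD comp_polyM comp_polyX comp_polyC !rmorphD !rmorphM rmorphN.
  by rewrite !iev_X !iev_C IH.
have inv (p : {poly int}) : (p \Po - 'X) \Po - 'X = p.
  by rewrite -comp_polyA rmorphN /= comp_polyX opprK comp_polyXr.
by move=> p q; rewrite !e => /iev_vinv_inj /(congr1 (fun r => r \Po - 'X));
  rewrite !inv.
Qed.

Lemma iev_vinv_rev (q : {poly int}) :
  exists2 r : {poly int}, (size r <= size q)%N &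
    v ^+ (size q).-1 * iev v^-1 q = iev v r.
Proof.
exists (\sum_(j < size q) q`_j *: 'X^((size q).-1 - j)).
  apply: (leq_trans (size_sum _ _ _)); apply/bigmax_leqP => j _.
  rewrite (leq_trans (size_scale_leq _ _)) // size_polyXn.
  by have := ltn_ord j; lia.
have v0 := v_neq0 R.
have E t (c : int) m : iev t (c *: 'X^m) = c%:~R * t ^+ m.
  by rewrite -mul_polyC rmorphM rmorphXn iev_X iev_C.
have qE : iev v^-1 q = \sum_(j < size q) (q`_j)%:~R * v^-1 ^+ j.
  rewrite -[in LHS](coefK q) poly_def raddf_sum; apply: eq_bigr => j _;
    exact: (E _ _ j).
rewrite qE raddf_sum mulr_sumr; apply: eq_bigr => j _.
have js : (j <= (size q).-1)%N by have := ltn_ord j; lia.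
rewrite [RHS]E mulrCA exprVn; congr (_ * _).
by rewrite -{1}(subnK js) exprD mulfK ?expf_neq0.
Qed.

(** Multiplying by v to the degree of q turns the right-hand side into a polynomial in v of at most
    that degree, so p has degree at most 0. *)
Lemma iev_v_vinv_const (p q : {poly int}) : iev v p = iev v^-1 q -> (size p <= 1)%N.
Proof.
move=> e; have [r sr rE] := iev_vinv_rev q.
have [->|p0] := eqVneq p 0; first by rewrite size_poly0.
have q0 : q != 0.
  by apply: contraNneq p0 => q0; apply/eqP/iev_v_inj; rewrite e q0 !rmorph0.
have : 'X^((size q).-1) * p = r.
  by apply: iev_v_inj; rewrite rmorphM rmorphXn iev_X -rE e.
move=> rE'; move: sr; rewrite -rE' mulrC size_mulXn //.
have : (0 < size q)%N by rewrite size_poly_gt0.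
by lia.
Qed.

End Scalars.

Section QuantumIntegers.
Variable R : realType.
Local Notation K := {fraction {poly R[i]}}.
Local Notation v := (v R).

Lemma qint_bar m : subst_vinv (qint R m) = qint R m.
Proof.
rewrite /qint raddf_sum (reindex_inj rev_ord_inj) /=; apply: eq_bigr => j _.
rewrite fmorphXz /= subst_vinv_v exprz_inv; congr (v ^ _).
by have := ltn_ord j; rewrite !mulr2n; lia.
Qed.

(** After clearing denominators, the quantum integer takes the value m at v = 1. *)
Lemma qint_neq0 m : (0 < m)%N -> qint R m != 0.
Proof.
move=> m0; have v0 := v_neq0 R.
have e : v ^ (m%:Z - 1) * qint R m = iev v (\sum_(j < m) 'X^(2 * j)).
  rewrite /qint mulr_sumr raddf_sum; apply: eq_bigr => j _.
  have X k : iev v 'X^k = v ^+ k by rewrite rmorphXn iev_X.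
  by rewrite -expfzDr // [RHS]X exprnP; congr (v ^ _); rewrite mulr2n; lia.
apply: contraTneq m0 => m0; move: e; rewrite m0 mulr0 => /esym /eqP.
rewrite -(rmorph0 (iev v)) (inj_eq (@iev_v_inj R)) => /eqP /(congr1 (fun p => p.[1])).
rewrite horner0 horner_sum; under eq_bigr do rewrite hornerXn expr1n.
by rewrite sumr_const card_ord => /eqP; rewrite pnatr_eq0 => /eqP ->.
Qed.

Lemma qfact_bar m : subst_vinv (qfact R m) = qfact R m.
Proof. by rewrite /qfact rmorph_prod; apply: eq_bigr => j _; exact: qint_bar. Qed.

Lemma qfact_neq0 m : qfact R m != 0.
Proof. by apply/prodf_neq0 => j _; exact: qint_neq0. Qed.

End QuantumIntegers.

(** * Horizontal ribbon strips *)

Lemma size_le_psize (l : intpart) : (size l <= psize l)%N.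
Proof.
rewrite (psizeE (leqnn _)) -{1}[size l]card_ord -sum1_card leq_sum // => a _.
by rewrite lt0n row_len_eq0 -ltnNge.
Qed.

Lemma row_len_le_psize (l : intpart) a : (row_len l a <= psize l)%N.
Proof.
have [la|al] := leqP (size l) a;
  first by have /eqP -> : row_len l a == 0%N by rewrite row_len_eq0.
by rewrite (psizeE (leqnn _)) (bigD1 (Ordinal al)) //= leq_addr.
Qed.

Section Tilings.
Variables (n k : nat) (l m : intpart).
Local Notation cell := ('I_(psize m) * 'I_(psize m))%type.

Lemma ribbon_content (t : n.-tuple cell) (d : cell) j : is_ribbon t -> (j < n)%N ->
  (nth d t j).2%:Z - (nth d t j).1%:Z
  = (nth d t 0).2%:Z - (nth d t 0).1%:Z - j%:Z.
Proof.
rewrite /is_ribbon => rt; elim: j => [|j IH] jn; first by rewrite subr0.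
have := IH (ltnW jn); have jt : (j.+1 < size t)%N by rewrite size_tuple.
move/(sortedP d)/(_ j jt): rt; rewrite /ribbon_step.
by case/orP => /andP[/eqP e /eqP e']; rewrite ?e ?e'; lia.
Qed.

Lemma ribbon_uniq (t : n.-tuple cell) : is_ribbon t -> uniq t.
Proof.
move=> rt; case E: (val t) => [//|c0 s]; rewrite -E {E s}.
apply/(uniqP c0) => a b; rewrite !inE size_tuple => an bn e.
have := ribbon_content c0 rt an.
by rewrite e (ribbon_content c0 rt bn); lia.
Qed.

Variable T : {set n.-tuple cell}.
Hypothesis tT : horizontal_tiling k l T.

Lemma tiling_ribbon t : t \in T -> is_ribbon t /\ head_ok l t.
Proof. by case/and4P: tT => _ _ /forall_inP h _ /h /andP. Qed.

Lemma tiling_sub a : (row_len l a <= row_len m a)%N.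
Proof.
have [la|al] := leqP (size l) a;
  first by have /eqP -> : row_len l a == 0%N by rewrite row_len_eq0.
by case/and4P: tT => /forallP/(_ (Ordinal al)).
Qed.

Lemma tiling_card : #|T| = k.
Proof. by case/and4P: tT => _ /eqP. Qed.

Lemma tiling_cover c : in_skew l c -> exists2 t, t \in T & c \in val t.
Proof.
move=> sc; case/and4P: tT => _ _ _ /forallP/(_ c); rewrite sc => /eqP h.
have : (0 < #|[set t in T | c \in val t]|)%N by rewrite h.
by case/card_gt0P => t; rewrite inE => /andP[]; exists t.
Qed.

Lemma tiling_skew t c : t \in T -> c \in val t -> in_skew l c.
Proof.
move=> tin cin; case/and4P: tT => _ _ _ /forallP/(_ c) /eqP e.
have : (0 < #|[set t in T | c \in val t]|)%N by apply/card_gt0P; exists t;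
  rewrite inE tin.
by rewrite e lt0b.
Qed.

Lemma tiling_sum (V : nmodType) (f : cell -> V) :
  \sum_(c | in_skew l c) f c = \sum_(t in T) \sum_(c <- t) f c.
Proof.
transitivity (\sum_(c : cell) \sum_(t in T | c \in val t) f c).
  rewrite big_mkcond; apply: eq_bigr => c _; rewrite sumr_const.
  have -> : #|[pred t in T | c \in val t]| = in_skew l c.
    case/and4P: tT => _ _ _ /forallP/(_ c) /eqP <-; apply: eq_card => t.
    by rewrite !inE.
  by case: (in_skew l c).
rewrite (exchange_big_dep (mem T)) /=; last by move=> c t _ /andP[].
apply: eq_bigr => t tin; have [rt _] := tiling_ribbon tin.
rewrite big_uniq ?ribbon_uniq //=; apply: eq_bigl => c.
by rewrite tin.
Qed.

Lemma skew_sum (V : zmodType) (f : nat -> nat -> V) N : (size m <= N)%N ->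
  \sum_(c : cell | in_skew l c) f c.1 c.2
  = \sum_(a < N) (\sum_(b < row_len m a) f a b - \sum_(b < row_len l a) f a b).
Proof.
move=> mN; pose g a := \sum_(b < row_len m a) f a b - \sum_(b < row_len l a) f a b.
have gE (a : nat) : g a = \sum_(b < psize m | (row_len l a <= b < row_len m a)%N) f a b.
  rewrite /g (big_ord_widen _ (f a) (row_len_le_psize m a)).
  have lp := leq_trans (tiling_sub a) (row_len_le_psize m a).
  rewrite (big_ord_widen _ (f a) lp).
  rewrite (bigID (fun b : 'I_(psize m) => (b < row_len l a)%N)) /=.
  rewrite (eq_bigl (fun b : 'I_(psize m) => (b < row_len l a)%N)) => [|b].
    rewrite addrAC subrr add0r; apply: eq_bigl => b /=.
    by rewrite -leqNgt andbC.
  by case: (ltnP b (row_len l a)) => bl;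
    rewrite ?andbF // andbT (leq_trans bl (tiling_sub a)).
rewrite -(pair_big_dep xpredT (fun a b : 'I_(psize m) => in_skew l (a, b)) (fun a b =>
  f a b)) /=.
transitivity (\sum_(a < psize m) g a); first by apply: eq_bigr => a _; rewrite gE.
have g0 (a : nat) : (size m <= a)%N -> g a = 0.
  move=> ma; have /eqP rm : row_len m a == 0%N by rewrite row_len_eq0.
  by rewrite gE big1 // => b; rewrite rm andbF.
have E M : (size m <= M)%N -> \sum_(a < M) g a = \sum_(a < size m) g a.
  move=> mM; rewrite -(subnKC mM) big_split_ord /= [X in _ + X]big1 ?addr0 // => a _.
  by rewrite g0 // leq_addr.
by rewrite !E // size_le_psize.
Qed.

End Tilings.

Section TilingContent.
Variable n : nat.
Hypothesis n_gt1 : (1 < n)%N.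

Lemma strip_spinP k l m d : strip_spin n k l m = Some d ->
  exists2 T : {set n.-tuple ('I_(psize m) * 'I_(psize m))},
    horizontal_tiling k l T & d = (\sum_(t in T) ribbon_spin t)%N.
Proof. by rewrite /strip_spin; case: pickP => //= T tT [<-]; exists T. Qed.

(** Contents decrease by one along a ribbon, so its n cells represent each residue once. *)
Lemma rescount_strip k l m d (r : int) : strip_spin n k l m = Some d ->
  rescount n r m = rescount n r l + k%:Z.
Proof.
case/strip_spinP => T tT _; pose N := (size l + size m)%N.
have mN : (size m <= N)%N by rewrite leq_addl.
rewrite !(rescount_widen n r (N := N)) ?leq_addr //.
rewrite -[LHS](addrNK (\sum_(a < N) \sum_(b < row_len l a) (has_res n r (b%:Z -
  a%:Z))%:Z)).
rewrite -sumrB [LHS]addrC; congr (_ + _).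
rewrite -(skew_sum tT (fun a b => (has_res n r (b%:Z - a%:Z))%:Z)) // (tiling_sum tT).
rewrite (eq_bigr (fun=> 1)) => [|t tin].
  by rewrite sumr_const (tiling_card tT) natz.
have [rt _] := tiling_ribbon tT tin.
have [c0 _] : exists c0 : 'I_(psize m) * 'I_(psize m), true.
  by case: (val t) (size_tuple t) => [/= n0|c0 s _]; [move: n_gt1;
    rewrite -n0 | exists c0].
rewrite (big_nth c0) big_mkord size_tuple -[RHS](sum_res n_gt1 ((nth c0 t 0).2%:Z -
  (nth c0 t 0).1%:Z - r)).
apply: eq_bigr => j _; rewrite ribbon_content // !resE.
by rewrite addrAC.
Qed.

End TilingContent.

(** The classical statistic n(lambda), the sum of the row indices of all cells. *)
Definition nstat (l : intpart) : nat := (\sum_(a < size l) a * row_len l a)%N.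

Lemma nstat_widen (l : intpart) N : (size l <= N)%N ->
  nstat l = (\sum_(a < N) a * row_len l a)%N.
Proof.
move=> lN; rewrite -(subnKC lN) big_split_ord /= [X in (_ + X)%N]big1 ?addn0 // => a _.
by have /eqP -> : row_len l (size l + a) == 0%N; rewrite ?row_len_eq0 ?leq_addr ?muln0.
Qed.

Lemma nstat_le (l : intpart) : (nstat l <= psize l * psize l)%N.
Proof.
rewrite {2}(psizeE (leqnn _)) big_distrr /= leq_sum // => a _.
by rewrite leq_mul2r (leq_trans (ltnW (ltn_ord a)) (size_le_psize l)) orbT.
Qed.

Lemma size_row_le (l m : intpart) : (forall a, row_len l a <= row_len m a)%N ->
  (size l <= size m)%N.
Proof. by move=> h;
  rewrite -row_len_eq0 -leqn0 (leq_trans (h _)) // leqn0 row_len_eq0. Qed.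

(** Spin 0 means a single row, and the condition on the top-right cell places that row at most one
    below the last row of [l]. *)
Lemma horizontal_ribbon_row n l m (t : n.-tuple ('I_(psize m) * 'I_(psize m))) :
  head_ok l t -> ribbon_spin t = 0%N ->
  exists2 r, (r <= size l)%N & forall c, c \in val t -> nat_of_ord c.1 = r.
Proof.
rewrite /head_ok /ribbon_spin -[val t]/(tval t); case: (tval t) => // c s hd;
  set U := undup _ => sp.
have row d : d \in c :: s -> d.1 = c.1.
  move=> din; have u : uniq [:: d.1; c.1] -> False.
    move=> u; suff : (2 <= size U)%N by lia.
    apply: (uniq_leq_size u) => x; rewrite mem_undup;
      rewrite mem_seq2 => /orP[] /eqP ->.
      exact: (map_f fst).
    by apply: (map_f fst); rewrite mem_head.
  by move: u; rewrite /= inE andbT; case: eqP => // _ /(_ isT).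
exists c.1 => [|d /row -> //]; case/orP: hd => [/eqP -> //|].
case: (nat_of_ord c.1) => // r /= hr; rewrite ltnNge; apply/negP => lr.
by move: hr; have /eqP -> : row_len l r == 0%N by rewrite row_len_eq0.
Qed.

Section HorizontalStrips.
Variable n : nat.
Hypothesis n_gt1 : (1 < n)%N.
Variables (k : nat) (l m : intpart).

Section SpinZero.
Hypothesis spin0 : strip_spin n k l m = Some 0%N.

Lemma spin0_dvd : (forall a, n %| row_len l a)%N -> forall a, (n %| row_len m a)%N.
Proof.
move=> dl a; have [T tT /esym/eqP] := strip_spinP spin0;
  rewrite sum_nat_eq0 => /forall_inP sp.
suff : (n%:Z %| (row_len m a)%:Z - (row_len l a)%:Z)%Z.
  by move=> h; have := rpredD h (dl a : (n%:Z %| (row_len l a)%:Z)%Z); rewrite subrK.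
pose N := (size m + a.+1)%N; have aN : (a < N)%N by rewrite /N; lia.
(* With the indicator of row a as weight, the sum counts the new cells of that row, and each ribbon
   contributes 0 or n. *)
have := skew_sum tT (fun x _ => (x == a : nat)%:Z) (leq_addr a.+1 (size m)).
rewrite -/N (bigD1 (Ordinal aN)) //= [X in _ + X]big1 => [|x]; last first.
  by rewrite -val_eqE /= => /negPf ->; rewrite !big1 ?subrr.
rewrite !sumr_const eqxx !card_ord !natz addr0 => <-.
rewrite (tiling_sum tT) rpred_sum // => t tin.
have [rt hd] := tiling_ribbon tT tin.
have [r _ rE] := horizontal_ribbon_row hd (eqP (sp t tin)).
rewrite (eq_big_seq (fun=> (r == a : nat)%:Z)) => [|c cin]; last by rewrite rE.
by rewrite big_const_seq count_predT size_tuple iter_addr addr0 -mulr_natl natz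
  dvdz_mulr.
Qed.

(** All n k new cells lie in rows up to [size l]; the bound is attained only if they all lie in the
    row just below [l]. *)
Lemma spin0_nstat :
  (nstat m <= nstat l + size l * (n * k))%N
  /\ ((exists2 a, a != size l & row_len m a != row_len l a) ->
     (nstat m < nstat l + size l * (n * k))%N).
Proof.
have [T tT /esym/eqP] := strip_spinP spin0; rewrite sum_nat_eq0 => /forall_inP sp.
have ls : (size l <= size m)%N by apply: size_row_le; exact: tiling_sub tT.
pose F (t : n.-tuple ('I_(psize m) * 'I_(psize m))) := \sum_(c <- t) (nat_of_ord
  c.1)%:Z.
have e : (nstat m)%:Z = (nstat l)%:Z + \sum_(t in T) F t.
  rewrite -(tiling_sum tT (fun c => (nat_of_ord c.1)%:Z)).
  rewrite (skew_sum tT (fun x _ => x%:Z) (leqnn _)) (nstat_widen ls) /nstat.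
  rewrite !(big_morph Posz PoszD (erefl _)) -big_split; apply: eq_bigr => a _ /=.
  have cst j : \sum_(b < j) (nat_of_ord a)%:Z = (a * j)%N%:Z.
    by rewrite sumr_const card_ord -mulr_natr natz PoszM.
  by rewrite !cst addrC subrK.
have row t : t \in T -> exists2 r, (r <= size l)%N &
    (forall c, c \in val t -> nat_of_ord c.1 = r) /\ F t = (n * r)%N.
  move=> tin; have [rt hd] := tiling_ribbon tT tin.
  have [r rl rE] := horizontal_ribbon_row hd (eqP (sp t tin)); exists r => //;
    split=> //.
  rewrite /F (eq_big_seq (fun=> r%:Z)) => [|c cin]; last by rewrite rE.
  by rewrite big_const_seq count_predT size_tuple iter_addr addr0 -mulr_natl natz PoszM.
have Fle t : t \in T -> F t <= (n * size l)%N%:Z.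
  by move=> tin; have [r rl [_ ->]] := row t tin; rewrite lez_nat leq_mul2l rl orbT.
have sumc : \sum_(t in T) (n * size l)%N%:Z = (size l * (n * k))%N%:Z.
  by rewrite sumr_const (tiling_card tT) -mulr_natr natz -PoszM; congr Posz; lia.
split; first by rewrite -lez_nat e PoszD lerD2l -sumc ler_sum.
case=> a al; rewrite neq_ltn => /orP[|]; first by rewrite ltnNge (tiling_sub tT).
move=> lm; rewrite -ltz_nat e PoszD ltrD2l -sumc.
have ap : (a < psize m)%N.
  apply: leq_trans (size_le_psize m); rewrite ltnNge -row_len_eq0 -lt0n.
  exact: leq_ltn_trans lm.
have bp : (row_len l a < psize m)%N by exact: leq_trans lm (row_len_le_psize m a).
have [t tin cin] : exists2 t, t \in T & (Ordinal ap, Ordinal bp) \in val t.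
  by apply: (tiling_cover tT); rewrite /in_skew /= leqnn.
have [r rl [rE Ft]] := row t tin; have /= ra := rE _ cin; subst r.
rewrite (bigD1 t tin) [X in _ < X](bigD1 t tin) /=.
apply: ltr_leD; last by apply: ler_sum => t' /andP[t'in _]; exact: Fle.
by rewrite Ft ltz_nat ltn_pmul2l ?(ltnW n_gt1) // ltn_neqAle al.
Qed.

End SpinZero.

Lemma row_tiling (k_gt0 : (0 < k)%N) (rows : forall a,
    row_len m a = if a == size l then (n * k)%N else row_len l a) :
  exists T : {set n.-tuple ('I_(psize m) * 'I_(psize m))}, horizontal_tiling k l T.
Proof.
have n_gt0 : (0 < n)%N := ltnW n_gt1.
have rl : row_len l (size l) = 0%N by apply/eqP; rewrite row_len_eq0.
have rm : row_len m (size l) = (n * k)%N by rewrite rows eqxx.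
have lm : (size l < psize m)%N.
  apply: leq_trans (size_le_psize m); rewrite ltnNge -row_len_eq0 -lt0n rm.
  by rewrite muln_gt0 n_gt0.
have nkm : (n * k <= psize m)%N by rewrite -rm row_len_le_psize.
pose o x : 'I_(psize m) := insubd (Ordinal lm) x.
have oE x : (x < n * k)%N -> o x = x :> nat.
  by move=> xk; rewrite val_insubd (leq_trans xk nkm).
(* The cells of the j-th bar from right to left, since a ribbon is listed from its top-right end. *)
pose C j r := (Ordinal lm, o (n * j + (n - r.+1))%N).
pose tl (j : 'I_k) := [tuple C j r | r < n].
have bd (j : 'I_k) r : (n * j + (n - r.+1) < n * k)%N.
  have : (n * j.+1 <= n * k)%N by rewrite leq_mul2l ltn_ord orbT.
  by rewrite mulnS; lia.
have nthE d (j : 'I_k) r : (r < n)%N -> nth d (tl j) r = C j r.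
  by move=> rn; rewrite -(tnth_nth d _ (Ordinal rn)) tnth_mktuple.
have memE (j : 'I_k) (c : 'I_(psize m) * 'I_(psize m)) :
    (c \in val (tl j)) = (c.1 == size l :> nat) && (c.2 %/ n == j)%N.
  apply/tnthP/andP => [[r ->]|[/eqP c1 /eqP c2]].
    rewrite tnth_mktuple /= eqxx oE // mulnC divnMDl // divn_small ?addn0 //.
    by have := ltn_ord r; lia.
  have c2n := divn_eq c.2 n; have cn := ltn_pmod c.2 n_gt0.
  have rn : (n - (c.2 %% n).+1 < n)%N by lia.
  exists (Ordinal rn); rewrite tnth_mktuple /C /= [LHS]surjective_pairing.
  congr (_, _); apply/val_inj => //=; rewrite oE //.
  by rewrite -c2 {1}c2n mulnC; lia.
have tl_inj : injective tl.
  move=> j j' e; have := memE j' (C j 0%N); rewrite -e memE /= eqxx oE //=.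
  rewrite mulnC divnMDl // divn_small ?addn0 ?eqxx => [/esym/eqP /val_inj //|].
  by lia.
have skewE c : @in_skew l m c = (c.1 == size l :> nat) && (c.2 < n * k)%N.
  rewrite /in_skew rows; case: eqP => [->|_]; first by rewrite rl.
  by case: leqP => //=; case: ltnP.
exists [set tl j | j : 'I_k]; apply/and4P; split.
- by apply/forallP => a; rewrite rows (ltn_eqF (ltn_ord a)).
- by rewrite card_imset // card_ord.
- apply/forall_inP => t /imsetP[j _ ->]; apply/andP; split.
    apply/(sortedP (C j 0%N)) => r; rewrite size_tuple => rn.
    rewrite !nthE // ?(ltnW rn) // /ribbon_step /= eqxx /= !oE //.
    by apply/orP; left; apply/eqP; lia.
  rewrite /head_ok; have := nthE (C j 0%N) j 0%N n_gt0.
  rewrite -[val _]/(tval (tl j));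
    case: (tval (tl j)) (size_tuple (tl j)) => [/= n0|c s _ /= ->].
    by move: n_gt0; rewrite -n0.
  rewrite /C /=; case: (posnP (size l)) => [-> //|l0]; apply/orP; right;
    rewrite /= oE //.
  have lE : (size l).-1 != size l by lia.
  apply: (leq_trans (bd j 0%N)); rewrite -rm -(prednK l0).
  have := rows (size l).-1; rewrite (negPf lE) => <-.
  exact: row_len_sorted.
- apply/forallP => c; rewrite skewE; case: (boolP (_ && _)) => [/andP[c1 c2]|nc].
    have jk : (c.2 %/ n < k)%N by rewrite ltn_divLR // mulnC.
    apply/eqP; transitivity #|[set tl (Ordinal jk)]|; last by rewrite cards1.
    apply: eq_card => t.
    rewrite !inE; apply/andP/eqP => [[/imsetP[j _ ->]]|->].
      by rewrite memE => /andP[_ /eqP e]; congr tl; apply/val_inj.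
    by rewrite imset_f // memE c1 eqxx.
  rewrite -[nat_of_bool false]/0%N cards_eq0; apply/eqP/setP => t; rewrite !inE;
    apply/negP => /andP[/imsetP[j _ ->]].
  rewrite memE => /andP[c1 /eqP c2]; case/negP: nc; rewrite c1 /= mulnC -ltn_divLR //.
  by rewrite c2.
Qed.

(** Whichever tiling [pick] returns, all its cells lie in the single row [size l]. *)
Lemma row_strip_spin (k_gt0 : (0 < k)%N) (rows : forall a,
    row_len m a = if a == size l then (n * k)%N else row_len l a) :
  strip_spin n k l m = Some 0%N.
Proof.
rewrite /strip_spin; case: pickP => [T tT|none] /=; last first.
  by have [T] := row_tiling k_gt0 rows; rewrite none.
congr Some; apply/eqP; rewrite sum_nat_eq0; apply/forall_inP => t tin.
have row c : c \in val t -> nat_of_ord c.1 = size l.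
  move=> cin; have := tiling_skew tT tin cin; rewrite /in_skew rows.
  by case: eqP => // _; case: leqP => //=; case: ltnP.
rewrite /ribbon_spin; set U := undup _.
suff : (size U <= 1)%N by case: (size U) => [|[]].
case EU: U => [//|x U']; rewrite -[1%N]/(size [:: x]); apply: uniq_leq_size.
  by rewrite -EU undup_uniq.
have Ux y : y \in U -> nat_of_ord y = size l.
  by rewrite mem_undup => /mapP[c cin ->]; exact: row.
move=> y; rewrite -EU inE => yU; apply/eqP/val_inj => /=.
by rewrite (Ux y) // (Ux x) // EU mem_head.
Qed.

End HorizontalStrips.

(** * Generation of the Fock space *)

Section Signature.
Variable n : nat.
Hypothesis n_gt1 : (1 < n)%N.

Section Descent.
Variables (i : nat) (l : intpart).
Local Notation A := (addable_i n i l).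
Local Notation Rm := (removable_i n i l).
Local Notation height := (height n i l).

(** A discrete intermediate value argument: [height] decreases only across removable rows, and by
    one each time. *)
Lemma height_descent x z c : (x <= z)%N -> c + 1 <= height x -> height z <= c ->
  exists2 y, (x <= y < z)%N & Rm y /\ height y = c + 1.
Proof.
elim: z => [|z IH]; first by rewrite leqn0 => /eqP -> h1 h2; lia.
rewrite leq_eqVlt => /predU1P[->|xz] h1 h2; first by lia.
have [sz|sz] := lerP (height z) c.
  by have [y yz yP] := IH xz h1 sz; exists y => //; lia.
have := h2; rewrite heightS; have := @addable_removable_i n i n_gt1 l z.
case: (boolP (Rm z)) => [rz|_]; case: (A z) => //= h; try lia.
by move=> h3; exists z; [lia|split=> //; lia].
Qed.

Variable a0 : nat.
Hypothesis rem0 : Rm a0.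
Hypothesis a0_last : forall y, (a0 < y)%N -> A y -> height y + 2 <= height a0.

(* The bottommost maximum of the signature over the removable nodes: it is
   where the leading term of F_i at v = oo adds a node. *)
Lemma leading_removable : exists2 a, Rm a &
  (forall y, (y < a)%N -> A y -> height y < height a) /\
  (forall y, (a < y)%N -> A y -> height y + 2 <= height a).
Proof.
(* Lexicographic order as one integer: the height decides first, then the row, whose index is
   smaller than the factor. *)
pose sz := size l; pose score a := height a * (sz.+1)%:Z + a%:Z.
pose P (a : 'I_sz) := Rm a.
have ha0 : P (Ordinal (removable_i_size rem0)) by [].
case: (Order.TotalTheory.arg_maxP (fun a : 'I_sz => score a) ha0) => a ra amax.
have smax y : Rm y -> height y <= height a.
  move=> ry; have ys := removable_i_size ry; have := amax (Ordinal ys) ry.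
  rewrite /score /= -/sz in ys *; have := ltn_ord a.
  have [//|h] := lerP (height y) (height a) => asz sc; exfalso.
  have : (height a + 1) * sz.+1%:Z <= height y * sz.+1%:Z by rewrite ler_wpM2r //; lia.
  by rewrite mulrDl mul1r; lia.
have smax_eq y : Rm y -> height y = height a -> (y <= a)%N.
  move=> ry e; have ys := removable_i_size ry; have := amax (Ordinal ys) ry.
  by rewrite /score /= e lerD2l lez_nat.
have up y : A y -> height y.+1 = height y + 1.
  by move=> ay; rewrite heightS ay (negPf (addable_removable_i n_gt1 ay)); lia.
exists a; first exact: ra.
split=> y ya ay.
  (* Just below such a y the height exceeds that of a, so the descent to a would cross a removable
     row higher than the maximum. *)
  rewrite ltNge; apply/negP => h; have := up y ay => e.
  have [z zP [rz sz']] := @height_descent y.+1 a (height a) ya ltac:(lia) (lexx _).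
  by have := smax z rz; lia.
have [//|h] := lerP (height y + 2) (height a); exfalso.
have sa0 := smax a0 rem0.
case: (ltngtP y a0) => [ya0|ya0|e].
- have := up y ay => e.
  have [e0|ne0] := eqVneq (height a0) (height a); first by have := smax_eq a0 rem0 e0;
    lia.
  have [z zP [rz sz']] := @height_descent y.+1 a0 (height a - 1) ya0 ltac:(lia)
    ltac:(lia).
  by have := smax_eq z rz; rewrite sz' subrK => /(_ erefl); lia.
- by have := a0_last ya0 ay; lia.
- by have := addable_removable_i n_gt1 ay; rewrite e rem0.
Qed.

End Descent.

Lemma last_indivisible_row (l : intpart) : ~~ all (fun x => n %| x)%N l ->
  exists2 a0, ~~ (n %| row_len l a0)%N & forall y, (a0 < y)%N -> (n %| row_len l y)%N.
Proof.
move=> /(all_nthP 0%N) h.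
have ex : exists a, (a < size l)%N && ~~ (n %| row_len l a)%N.
  case: (boolP [exists a : 'I_(size l), ~~ (n %| row_len l a)%N]) => [/existsP[a aP]|].
    by exists a; rewrite ltn_ord.
  rewrite negb_exists => /forallP h'; case: h => a al.
  by have := h' (Ordinal al); rewrite negbK.
have bd a : (a < size l)%N && ~~ (n %| row_len l a)%N -> (a <= size l)%N by case/andP
  => /ltnW.
case: (ex_maxnP ex bd) => a /andP[al na] amax; exists a => // y ay.
apply/negPn/negP => ny; have yl : (y < size l)%N.
  by rewrite ltnNge -row_len_eq0; apply: contraNN ny => /eqP ->.
by have := amax y; rewrite yl ny => /(_ isT); lia.
Qed.

(** i is the residue of the end of the last row a0 of length not divisible by n. Below a0 all
    lengths are multiples of n, so row y has a removable i-node exactly when row y+1 has an addable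
    one. These pairs cancel in the signature, and every addable i-node below a0 has height
    [height a0 - 2]. *)
Lemma leading_node (l : intpart) : ~~ all (fun x => n %| x)%N l ->
  exists i a, [/\ (i < n)%N, removable_i n i l a,
    forall y, (y < a)%N -> addable_i n i l y -> height n i l y < height n i l a &
    forall y, (a < y)%N -> addable_i n i l y -> height n i l y + 2 <= height n i l a].
Proof.
move=> /last_indivisible_row[a0 na0 later].
have n0 : n%:Z != 0 by lia.
pose i := absz ((beta l a0 - 1) %% n%:Z)%Z.
have iE : i%:Z = ((beta l a0 - 1) %% n%:Z)%Z by rewrite gez0_abs ?modz_ge0.
have i_lt : (i < n)%N by have := ltz_mod (beta l a0 - 1) n0; rewrite -iE; lia.
have resi c : has_res n i c = has_res n (beta l a0 - 1) c by apply: res_mod;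
  rewrite iE modz_mod.
have rem0 : removable_i n i l a0.
  rewrite removable_iE // resi /has_res eqxx andbT /removable ltn_neqAle
    row_len_sorted // andbT.
  by apply: contraNneq na0 => <-; exact: later.
have dvdE c d : (n%:Z %| d)%Z -> has_res n i (c + d) = has_res n i c.
  move=> dv; rewrite !resE; have -> : c + d - i%:Z = (c - i%:Z) + d by ring.
  by rewrite rpredDr.
have couple y : (a0 < y)%N -> removable_i n i l y = addable_i n i l y.+1.
  move=> ya; rewrite removable_iE // addable_iE /removable /addable /=; congr (_ && _).
  have -> : beta l y - 1 = beta l y.+1 + ((row_len l y)%:Z - (row_len l y.+1)%:Z).
    by rewrite /beta; lia.
  by apply: dvdE; apply: rpredB; [exact: later|exact/later/ltnW].
have a1 : addable_i n i l a0.+1 = false.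
  rewrite addable_iE; apply/negbTE/nandP; right; rewrite resi resE.
  have -> : beta l a0.+1 - (beta l a0 - 1) = (row_len l a0.+1)%:Z - (row_len l a0)%:Z.
    by rewrite /beta; lia.
  by rewrite rpredBl //; exact: later.
have tel y : height n i l (a0.+1 + y) + (addable_i n i l (a0.+1 + y))%:Z = height n i
  l a0 - 1.
  elim: y => [|y IH].
    rewrite addn0 a1 heightS rem0.
    by case: (boolP (addable_i n i l a0)) => [/(addable_removable_i n_gt1)|_];
      [rewrite rem0 | rewrite addr0; lia].
  by rewrite addnS -IH heightS couple ?ltn_addr //; lia.
have a0_last y : (a0 < y)%N -> addable_i n i l y -> height n i l y + 2 <= height n i l
  a0.
  move=> ya ay; have := tel (y - a0.+1)%N; rewrite subnKC // ay.
  by move=> /= h; lia.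
by have [a ra [h1 h2]] := leading_removable rem0 a0_last; exists i, a; split.
Qed.

(** Removing the node of row a turns a removable node into an addable one and raises the height of
    all lower rows by 2: this is the 2 in [leading_node]. Ties with row a can therefore only occur
    below it. *)
Lemma leading_predecessor (l : intpart) : ~~ all (fun x => n %| x)%N l ->
  exists i a m, [/\ (i < n)%N, addable_i n i m a, add_node m a = l,
    forall y, addable_i n i m y -> height n i m y <= height n i m a &
    forall y, addable_i n i m y -> height n i m y = height n i m a -> (a <= y)%N].
Proof.
move=> /leading_node[i [a [i_lt ra h1 h2]]].
pose m := mkpart (mkseq (fun y => row_len l y - (y == a))%N (size l)).
have mE y : row_len m y = (row_len l y - (y == a))%N.
  rewrite row_len_mkpart_mkseq => [|b _].
    case: ltnP => // ly; have /eqP -> : row_len l y == 0%N by rewrite row_len_eq0.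
    by rewrite sub0n.
  have := row_len_sorted l (leqnSn b); case: (eqVneq b a) => [->|_]; last by lia.
  by move=> _; move: ra => /andP[]; rewrite /removable; lia.
have la : (row_len l a.+1 < row_len l a)%N by case/andP: ra.
have ada : addable m a.
  rewrite /addable; case: (posnP a) => [->//|a_gt0] /=; rewrite !mE eqxx.
  have -> : (a.-1 == a) = false by lia.
  by have := row_len_sorted l (leq_pred a); lia.
have ad : addable_i n i m a.
  rewrite addable_iE ada; have := ra; rewrite removable_iE // => /andP[_].
  by congr (has_res _ _ _); rewrite /beta mE eqxx; lia.
have ml : add_node m a = l.
  apply: row_len_ext => y; rewrite row_len_add // mE.
  by case: eqP => [->|_]; lia.
have sE y : height n i m y = height n i l y + (a < y)%N%:Z *+ 2.
  elim: y => [|y IH]; first by rewrite /height !big_ord0.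
  rewrite !heightS IH -[in height n i l y]ml -[in addable_i n i l y]ml -[in
    removable_i n i l y]ml.
  rewrite (addable_i_add n_gt1 ad) (removable_i_add n_gt1 ad) ltnS.
  have := addable_removable_i n_gt1 ad; rewrite !mulr2n.
  by case: (ltngtP a y) => [ay|ay|<-]; rewrite ?ad ?andbT ?orbF ?andbF ?orbT /=;
    [lia|lia|move=> /negPf ->; lia].
have aE y : addable_i n i m y -> y != a -> addable_i n i l y.
  by move=> ay ya; rewrite -ml (addable_i_add n_gt1 ad) ay.
have key y : addable_i n i m y -> y != a ->
    height n i m y <= height n i m a /\ (height n i m y = height n i m a -> (a <= y)%N).
  move=> ay ya; have al := aE y ay ya; rewrite !sE ltnn !mulr2n.
  case: (ltngtP a y) ya => // [lt|lt] _.
    by have := h2 y lt al; split; lia.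
  by have := h1 y lt al; split; lia.
exists i, a, m; split=> // y ay; have [->|ya] := eqVneq y a; rewrite ?lexx //.
  by case: (key y ay ya).
by case: (key y ay ya).
Qed.

End Signature.

(** A kernel vector vanishes coordinate by coordinate, by induction on the rank. *)
Lemma triangular_det_neq0 N (C : 'M[int]_N) (rank : 'I_N -> nat) :
  (forall i, C i i != 0) ->
  (forall i j, C i j != 0 -> j != i -> (rank j < rank i)%N) -> \det C != 0.
Proof.
move=> diag tri; rewrite -det_tr; apply/det0P => [[u u0 uC]]; case/negP: u0.
apply/eqP/rowP => i; rewrite mxE.
have [m im] := ubnP (rank i); elim: m i im => // m IH i im.
have := congr1 (fun x : 'rV_N => x 0 i) uC; rewrite !mxE (bigD1 i) //= mxE big1.
  by rewrite addr0 => /eqP; rewrite mulf_eq0 (negPf (diag i)) orbF => /eqP.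
move=> j ji; rewrite mxE; have [->|Cij] := eqVneq (C i j) 0; first by rewrite mulr0.
by rewrite IH ?mul0r //; have := tri i j Cij ji; lia.
Qed.

Section Generation.
Variables (R : realType) (n : nat).
Hypothesis n_gt1 : (1 < n)%N.
Local Notation K := {fraction {poly R[i]}}.
Local Notation fock := (fock R).
Local Notation v := (v R).
Local Notation s := (fock_s R).

Variable W : fock -> Prop.
Hypothesis W_lin : forall (a : K) x y, W x -> W y -> W (a *: x + y).
Hypothesis W_empty : W (s empty_part).
Hypothesis W_F : forall i x, (i < n)%N -> W x -> W (fock_F n i x).
Hypothesis W_D : forall k x, (0 < k)%N -> W x -> W (fock_D n k x).

Let W0 : W 0.
Proof. by rewrite -(addNr (s empty_part)) -scaleN1r; exact: W_lin. Qed.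

Let WZ a x : W x -> W (a *: x).
Proof. by move=> Wx; rewrite -[_ *: _]addr0; exact: W_lin. Qed.

Let W_sum I (r : seq I) (P : pred I) (f : I -> fock) :
  (forall i, P i -> W (f i)) -> W (\sum_(i <- r | P i) f i).
Proof.
move=> h; elim/big_rec: _ => // i x Pi Wx.
by rewrite -[f i]scale1r; apply: W_lin => //; exact: h.
Qed.

(** The constant terms of the [p] describe the situation at v = oo. If they form a triangular
    matrix, the determinant of the whole matrix has a nonzero constant term, and the matrix is
    invertible over K. *)
Lemma span_triangular (r : seq intpart) (rank : intpart -> nat) : uniq r ->
  (forall l, l \in r -> exists p : intpart -> {poly int},
    [/\ W (\sum_(m <- r) iev v^-1 (p m) *: s m), (p l).[0] != 0 &
        forall m, m \in r -> (p m).[0] != 0 -> m != l -> (rank m < rank l)%N]) ->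
  forall l, l \in r -> W (s l).
Proof.
move=> ur h; pose N := size r; pose e (j : 'I_N) := nth empty_part r j.
have ein j : e j \in r by exact: mem_nth.
have /fin_all_exists[p pP] : forall j : 'I_N, exists p : intpart -> {poly int},
    [/\ W (\sum_(m <- r) iev v^-1 (p m) *: s m), (p (e j)).[0] != 0 &
        forall m, m \in r -> (p m).[0] != 0 -> m != e j -> (rank m < rank (e j))%N].
  by move=> j; exact: h.
pose P : 'M[{poly int}]_N := \matrix_(i, j) p i (e j).
have detP : \det P != 0.
  have : \det (map_mx (horner_eval (0 : int)) P) != 0.
    apply: (@triangular_det_neq0 _ _ (fun j => rank (e j))) => [j|i j].
      by rewrite !mxE; case: (pP j).
    rewrite !mxE => pij ji; case: (pP i) => _ _; apply => //.
    by rewrite nth_uniq.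
  by rewrite det_map_mx; apply: contraNneq => ->; rewrite rmorph0.
pose M := map_mx (iev v^-1) P.
have Mu : M \in unitmx.
  rewrite unitmxE unitfE det_map_mx -(rmorph0 (iev v^-1)).
  by rewrite (inj_eq (@iev_vinv_inj R)).
move=> l lr; have jP : (index l r < N)%N by rewrite index_mem.
have -> : l = e (Ordinal jP) by rewrite /e nth_index.
move: (Ordinal jP) => j {l lr jP}.
have -> : s (e j) = \sum_i invmx M j i *: \sum_(m <- r) iev v^-1 (p i m) *: s m.
  have E i : \sum_(m <- r) iev v^-1 (p i m) *: s m = \sum_k M i k *: s (e k).
    by rewrite (big_nth empty_part) big_mkord; apply: eq_bigr => k _; rewrite !mxE.
  under eq_bigr do rewrite E scaler_sumr.
  rewrite exchange_big /=.
  have mulE k : \sum_i invmx M j i * M i k = (j == k)%:R.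
    by have := congr1 (fun A : 'M_N => A j k) (mulVmx Mu); rewrite !mxE.
  under eq_bigr => k _ do (under eq_bigr do rewrite scalerA; rewrite -scaler_suml mulE).
  rewrite (bigD1 j) //= eqxx scale1r [X in _ + X]big1 ?addr0 // => k /negPf kj.
  by rewrite eq_sym kj scale0r.
by apply: W_sum => i _; apply: WZ; case: (pP i).
Qed.

Definition divisible (l : intpart) : bool := all (fun x => n %| x)%N l.

Lemma divisibleP l : reflect (forall a, n %| row_len l a)%N (divisible l).
Proof.
apply: (iffP (all_nthP 0%N)) => h a => [|_]; last exact: h.
have [la|al] := leqP (size l) a; last exact: h.
by have /eqP -> : row_len l a == 0%N by rewrite row_len_eq0.
Qed.

(* At v = oo, the leading terms of D_k only involve divisible partitions, and
   nstat decreases on the non-leading ones; for F_i, nstat increases. *)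
Definition rank (d : nat) (l : intpart) : nat :=
  if divisible l then nstat l else (2 * (d * d) + 1 - nstat l)%N.

Lemma mem_parts_psize d l : l \in parts d -> psize l = d.
Proof. by rewrite mem_parts => /eqP. Qed.

(** [m0] is [l] without its last row, of length n k; D_k restores that row with spin 0. Any other
    spin 0 strip puts cells into higher rows. *)
Lemma leading_D d l : (0 < d)%N -> l \in parts d -> divisible l ->
  (forall m, (psize m < d)%N -> W (s m)) ->
  exists p : intpart -> {poly int},
    [/\ W (\sum_(m <- parts d) iev v^-1 (p m) *: s m), (p l).[0] != 0 &
        forall m, m \in parts d -> (p m).[0] != 0 -> m != l -> (rank d m < rank d l)%N].
Proof.
move=> d_gt0 /mem_parts_psize ld dl IH; have n_gt0 : (0 < n)%N := ltnW n_gt1.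
pose b := (size l).-1; have sl : size l = b.+1.
  rewrite /b prednK // lt0n; apply: contraTneq d_gt0 => s0.
  by rewrite -ld (psizeE (leqnn _)) s0 big_ord0.
pose k := (row_len l b %/ n)%N.
have lb : row_len l b = (n * k)%N by rewrite mulnC divnK //; move/divisibleP: dl.
have k_gt0 : (0 < k)%N.
  have : row_len l b != 0%N by rewrite row_len_eq0 sl ltnn.
  by rewrite lb muln_eq0 negb_or lt0n => /andP[].
pose m0 := mkpart (mkseq (row_len l) b).
have m0E a : row_len m0 a = if (a < b)%N then row_len l a else 0%N.
  by apply: row_len_mkpart_mkseq => c _; rewrite row_len_sorted.
have sm0 : size m0 = b.
  have : (size m0 <= b)%N by rewrite -row_len_eq0 m0E ltnn.
  rewrite leq_eqVlt => /predU1P[//|lt].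
  have : row_len m0 (size m0) == 0%N by rewrite row_len_eq0.
  by rewrite m0E lt row_len_eq0 sl; lia.
have rows a : row_len l a = if a == size m0 then (n * k)%N else row_len m0 a.
  rewrite sm0 m0E; case: (ltngtP a b) => [//|ab|->//].
  by apply/eqP; rewrite row_len_eq0 sl.
have szd : (psize m0 + n * k)%N = d.
  rewrite -ld (psizeE (_ : size m0 <= b)%N) ?sm0 // (psizeE (_ : size l <= b.+1)%N)
    ?sl //.
  rewrite big_ord_recr /= -lb; congr (_ + _)%N; apply: eq_bigr => a _.
  by rewrite m0E ltn_ord.
have nst : nstat l = (nstat m0 + size m0 * (n * k))%N.
  rewrite (nstat_widen (_ : size l <= b.+1)%N) ?sl // (nstat_widen (_ : size m0 <=
    b)%N) ?sm0 //.
  rewrite big_ord_recr /= lb; congr (_ + _)%N; apply: eq_bigr => a _.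
  by rewrite m0E ltn_ord.
(* At 1/v this is the coefficient in D_k; its constant term survives exactly for spin 0. *)
pose p m : {poly int} := if strip_spin n k m0 m is Some e then (- 'X) ^+ e else 0.
have p0 m : ((p m).[0] != 0) = (strip_spin n k m0 m == Some 0%N).
  rewrite /p; case: (strip_spin n k m0 m) => [e|]; last by rewrite horner0 eqxx.
  rewrite horner_exp hornerN hornerX oppr0 expr0n.
  by case: e.
exists p; split.
- have -> : \sum_(m <- parts d) iev v^-1 (p m) *: s m = fock_D n k (s m0).
    rewrite fock_Ds szd; apply: eq_bigr => m _; rewrite /p.
    case: (strip_spin n k m0 m) => [e|]; last by rewrite rmorph0 scale0r.
    by rewrite rmorphXn rmorphN iev_X -exprVn invrN.
  apply: W_D => //; apply: IH; rewrite -szd -[X in (X < _)%N]addn0 ltn_add2l.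
  by rewrite muln_gt0 n_gt0.
- by rewrite p0 (row_strip_spin n_gt1 k_gt0 rows).
- move=> m /mem_parts_psize md; rewrite p0 => /eqP sp ml.
  have dm : divisible m.
    apply/divisibleP; apply: (spin0_dvd n_gt1 sp) => a.
    by rewrite m0E; case: ifP => // _; move/divisibleP: dl.
  rewrite /rank dm dl nst; have [_] := spin0_nstat n_gt1 sp; apply.
  case: (boolP [exists a : 'I_(size m + size l), (nat_of_ord a != size m0)
      && (row_len m a != row_len m0 a)]) => [/existsP[a /andP[ab ar]]|].
    by exists (nat_of_ord a).
  rewrite negb_exists => /forallP same; case/eqP: ml.
  have off a : a != size m0 -> row_len m a = row_len l a.
    move=> ab; rewrite rows (negPf ab); have [aN|aN] := ltnP a (size m + size l).
      by have := same (Ordinal aN); rewrite /= ab /= negbK => /eqP.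
    have /eqP -> : row_len m a == 0%N by rewrite row_len_eq0; lia.
    by rewrite m0E; case: ifP => //; lia.
  apply: row_len_ext => a; have [->|/off//] := eqVneq a (size m0).
  have bN : (size m0 < size m + size l)%N by rewrite sm0 sl; lia.
  have := ld;
    rewrite -md (psizeE (leq_addl (size m) (size l))) (psizeE (leq_addr (size l) (size
    m))).
  rewrite (bigD1 (Ordinal bN)) //= [X in _ = X](bigD1 (Ordinal bN)) //=.
  rewrite [X in (_ + X)%N = _](eq_bigr (fun j : 'I_(size m + size l) => row_len m j))
    => [/addIn //|j jb].
  by rewrite off.
Qed.

Lemma nstat_add (m : intpart) a : addable m a -> nstat (add_node m a) = (nstat m + a)%N.
Proof.
move=> ad; pose N := (size m + size (add_node m a) + a.+1)%N.
rewrite !(nstat_widen (N := N)); try (rewrite /N; lia).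
have aN : (a < N)%N by rewrite /N; lia.
rewrite (bigD1 (Ordinal aN)) //= [in RHS](bigD1 (Ordinal aN)) //= row_len_add // eqxx.
rewrite (eq_bigr (fun y : 'I_N => y * row_len m y)%N) => [|y]; first by lia.
by rewrite -val_eqE /= row_len_add // => /negPf ->.
Qed.

Lemma psize_add (m : intpart) a : addable m a -> psize (add_node m a) = (psize m).+1.
Proof.
move=> ad; pose N := (size m + size (add_node m a) + a.+1)%N.
rewrite !(psizeE (N := N)); try (rewrite /N; lia).
have aN : (a < N)%N by rewrite /N; lia.
rewrite (bigD1 (Ordinal aN)) //= [in RHS](bigD1 (Ordinal aN)) //= row_len_add // eqxx.
rewrite (eq_bigr (fun y : 'I_N => row_len m y)) => [|y]; first by lia.
by rewrite -val_eqE /= row_len_add // => /negPf ->.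
Qed.

(** Divided by its top power of v, F_i s(m0) has coefficients in Z[1/v]; their constant terms come
    from the rows of maximal height, the first of which yields [l]. *)
Lemma leading_F d l : l \in parts d -> ~~ divisible l ->
  (forall m, (psize m < d)%N -> W (s m)) ->
  exists p : intpart -> {poly int},
    [/\ W (\sum_(m <- parts d) iev v^-1 (p m) *: s m), (p l).[0] != 0 &
        forall m, m \in parts d -> (p m).[0] != 0 -> m != l -> (rank d m < rank d l)%N].
Proof.
move=> /mem_parts_psize ld dl IH.
have [i [a [m0 [i_lt ad m0l smax sfirst]]]] := leading_predecessor n_gt1 dl.
have addl y : addable_i n i m0 y -> addable m0 y by case/andP.
have a0 : (a < (size m0).+1)%N by rewrite ltnS (addable_i_size ad).
have v0 := v_neq0 R.
pose p m : {poly int} := \sum_(y < (size m0).+1 | addable_i n i m0 y && (add_node m0 y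
  == m))
  'X^(absz (height n i m0 a - height n i m0 y)).
have p0 m : (p m).[0] = \sum_(y < (size m0).+1 | addable_i n i m0 y && (add_node m0 y
  == m))
    (height n i m0 y == height n i m0 a : nat)%:R.
  rewrite /p horner_sum; apply: eq_bigr => y /andP[ay _].
  rewrite hornerXn expr0n absz_eq0 subr_eq0 eq_sym.
  by case: eqP.
have szd : d = (psize m0).+1 by rewrite -ld -m0l psize_add // addl.
exists p; split.
- have -> : \sum_(m <- parts d) iev v^-1 (p m) *: s m
      = v ^ (- height n i m0 a) *: fock_F n i (s m0).
    rewrite fock_Fs // scaler_sumr.
    transitivity (\sum_(m <- parts d) \sum_(y < (size m0).+1 | addable_i n i m0 y &&
      (add_node m0 y == m))
        v ^ (height n i m0 y - height n i m0 a) *: s m).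
      apply: eq_bigr => m _; rewrite -scaler_suml; congr (_ *: _).
      rewrite /p raddf_sum; apply: eq_bigr => y /andP[ay _].
      have X k : iev v^-1 'X^k = v^-1 ^+ k by rewrite rmorphXn iev_X.
      rewrite [LHS]X exprnP exprz_inv; congr (v ^ _).
      by have := smax y ay; lia.
    rewrite (exchange_big_dep (fun y : 'I__ => addable_i n i m0 y)) /=;
      last by move=> m y _ /andP[].
    apply: eq_bigr => y ay; rewrite scalerA -expfzDr // [- _ + _]addrC.
    have yd : add_node m0 y \in parts d by rewrite mem_parts szd psize_add // addl.
    rewrite (eq_bigl (fun m => m == add_node m0 y)) => [|m]; last by rewrite ay eq_sym.
    by rewrite -big_filter (filter_pred1_uniq (parts_uniq d) yd) big_seq1.
  by apply/WZ/W_F => //; apply: IH; rewrite szd.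
- rewrite p0 (bigD1 (Ordinal a0)) /=; last by rewrite ad m0l eqxx.
  by rewrite eqxx; apply: lt0r_neq0; rewrite ltr_wpDr // sumr_ge0.
- move=> m md; rewrite p0 => pm ml.
  have [y ay /eqP ym] : exists2 y : 'I_(size m0).+1,
      addable_i n i m0 y && (add_node m0 y == m) & height n i m0 y == height n i m0 a.
    apply/exists_inP; apply: contraNT pm; rewrite negb_exists_in => /forall_inP h.
    by rewrite big1 // => y /h /negPf ->.
  case/andP: ay => ay /eqP ymE; have := sfirst y ay ym;
    rewrite leq_eqVlt => /predU1P[e|ya].
    by case/eqP: ml; rewrite -ymE -e.
  have nl : nstat l = (nstat m0 + a)%N by rewrite -m0l nstat_add // addl.
  have nm : nstat m = (nstat m0 + y)%N by rewrite -ymE nstat_add // addl.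
  (* As [nstat] is at most d^2, the shift 2 d^2 + 1 in [rank] places every partition that is not
     divisible above all divisible ones. *)
  have := nstat_le l; have := nstat_le m; rewrite ld (mem_parts_psize md).
  by rewrite /rank (negPf dl); case: ifP => _; lia.
Qed.

(* In degree d, every s(l) is the leading term at v = oo of some F_i s(m) or
   D_k s(m) with m of smaller degree, in a way that is triangular for rank. *)
Lemma fock_generated x : W x.
Proof.
suff h l : W (s l) by rewrite [x]fock_sum; apply: W_sum => l _; exact: WZ.
have [d ld] := ubnP (psize l); elim: d l ld => // d IH l; rewrite ltnS leq_eqVlt.
case/predU1P => [ld|]; last exact: IH.
have [d0|d_gt0] := posnP d.
  suff -> : l = empty_part by [].
  apply: row_len_ext => a; have := row_len_le_psize l a; rewrite ld d0 leqn0 => /eqP ->.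
  by rewrite /row_len nth_nil.
apply: (span_triangular (rank := rank d) (parts_uniq d)); last by rewrite mem_parts ld.
by move=> m md; have [dm|dm] := boolP (divisible m);
  [exact: leading_D|exact: leading_F].
Qed.

End Generation.

(** * Weight spaces and the bar involution *)

(** For a generator [f], a weight projection [p] and the projection [q] on the weight that [f]
    carries to it. *)
Lemma commute_through (T : Type) (bar p q f : T -> T) x :
  (forall y, p (f y) = f (q y)) -> (forall y, bar (f y) = f (bar y)) ->
  bar (q x) = q (bar x) -> bar (p (f x)) = p (bar (f x)).
Proof. by move=> pf bf h; rewrite pf bf h bf pf. Qed.

Section WeightSpaces.
Variables (R : realType) (n : nat).
Hypothesis n_gt1 : (1 < n)%N.
Local Notation K := {fraction {poly R[i]}}.
Local Notation fock := (fock R).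
Local Notation v := (v R).
Local Notation s := (fock_s R).

Definition content (l : intpart) : {ffun 'I_n -> int} := [ffun r : 'I_n => rescount n
  r%:Z l].

Lemma contentP l m : content l = content m <-> forall r, rescount n r l = rescount n r
  m.
Proof.
split=> [/ffunP e r|e]; last by apply/ffunP => r; rewrite !ffunE e.
have n0 : n%:Z != 0 by lia.
pose k := absz (r %% n%:Z)%Z.
have kE : k%:Z = (r %% n%:Z)%Z by rewrite gez0_abs ?modz_ge0.
have kn : (k < n)%N by have := ltz_mod r n0; rewrite -kE; lia.
have rE l' : rescount n r l' = rescount n k%:Z l' by apply: rescount_mod;
  rewrite kE modz_mod.
by have := e (Ordinal kn); rewrite !ffunE !rE.
Qed.

Lemma content_psize l m : content l = content m -> psize l = psize m.
Proof.
move/contentP => e; suff [] : (psize l)%:Z = psize m by [].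
by rewrite !(sum_rc n_gt1); apply: eq_bigr => r _.
Qed.

Definition wproj (w : {ffun 'I_n -> int}) : fock -> fock :=
  lin_ext (fun l => if content l == w then s l else 0).

HB.instance Definition _ w := GRing.isLinear.Build K fock fock *:%R
  (wproj w) (lin_ext_is_linear _).

Lemma wproj_s w l : wproj w (s l) = if content l == w then s l else 0.
Proof. exact: lin_ext_s. Qed.

Lemma wprojZ w (a : K) x : wproj w (a *: x) = a *: wproj w x.
Proof. exact: linearZ_LR. Qed.

Lemma wprojP w (a : K) x y : wproj w (a *: x + y) = a *: wproj w x + wproj w y.
Proof. exact: linearP. Qed.

Lemma wproj_sum w I (r : seq I) (P : pred I) (f : I -> fock) :
  wproj w (\sum_(j <- r | P j) f j) = \sum_(j <- r | P j) wproj w (f j).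
Proof. exact: raddf_sum. Qed.

Lemma fock_coef (x : fock) m : x@_m = \sum_(l <- msupp x) x@_l * (l == m)%:R.
Proof.
rewrite {1}[x]fock_sum raddf_sum; apply: eq_bigr => l _.
by rewrite /= mcoeffZ fock_sE.
Qed.

Lemma wprojE w x m : (wproj w x)@_m = if content m == w then x@_m else 0.
Proof.
rewrite lin_ext_coef fock_coef.
have -> : (if content m == w then \sum_(l <- msupp x) x@_l * (l == m)%:R else 0)
    = \sum_(l <- msupp x) x@_l * (if content m == w then (l == m)%:R else 0).
  by case: eqP => // _; rewrite big1 // => l _; rewrite mulr0.
apply: eq_bigr => l _; congr (_ * _); case: (eqVneq l m) => [->|lm].
  by case: eqP; rewrite ?fock_sE ?eqxx ?mcoeff0.
by case: eqP; rewrite ?fock_sE ?(negPf lm) ?mcoeff0 // if_same.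
Qed.

Lemma linear_fock_ext (f g : {linear fock -> fock}) :
  (forall l, f (s l) = g (s l)) -> f =1 g.
Proof.
move=> h x; rewrite [x]fock_sum !linear_sum; apply: eq_bigr => l _.
by rewrite !linearZ_LR h.
Qed.

Lemma wproj_F w i x :
  wproj w (fock_F n i x) = fock_F n i (wproj (w - [ffun r : 'I_n => (has_res n r
    i)%:Z]) x).
Proof.
set u := [ffun r => _].
apply: (@linear_fock_ext (wproj w \o @fock_F R n i) (@fock_F R n i \o wproj (w - u)))
  => l /=.
rewrite wproj_s (fock_Fs R i l n_gt1) wproj_sum.
have cE a : addable_i n i l a -> (content (add_node l a) == w) = (content l == w - u).
  move=> ad; rewrite -[RHS]subr_eq0 opprB addrA subr_eq0; congr (_ == _).
  by apply/ffunP => r; rewrite !ffunE (rescount_add n_gt1 _ ad).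
case: ifP => e; [rewrite (fock_Fs R i l n_gt1)|rewrite linear0 [LHS]big1 // => a ad].
  by apply: eq_bigr => a ad; rewrite wprojZ wproj_s (cE a ad) e.
by rewrite wprojZ wproj_s (cE a ad) e scaler0.
Qed.

Lemma wproj_D w k x :
  wproj w (fock_D n k x) = fock_D n k (wproj (w - [ffun=> k%:Z]) x).
Proof.
set u := [ffun=> _].
apply: (@linear_fock_ext (wproj w \o @fock_D R n k) (@fock_D R n k \o wproj (w - u)))
  => l /=.
rewrite wproj_s fock_Ds wproj_sum.
have cE m d : strip_spin n k l m = Some d -> (content m == w) = (content l == w - u).
  move=> sp; rewrite -[RHS]subr_eq0 opprB addrA subr_eq0; congr (_ == _).
  by apply/ffunP => r; rewrite !ffunE (rescount_strip n_gt1 _ sp).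
case: ifP => e; [rewrite fock_Ds|rewrite linear0 [LHS]big1 // => m _].
  apply: eq_bigr => m _; case sp: strip_spin => [d|]; last by rewrite linear0.
  by rewrite wprojZ wproj_s (cE _ _ sp) e.
case sp: strip_spin => [d|]; last by rewrite linear0.
by rewrite wprojZ wproj_s (cE _ _ sp) e scaler0.
Qed.

Variable bar : fock -> fock.
Hypothesis barP : is_bar n bar.

Lemma bar_lin (q : K) x y : bar (q *: x + y) = subst_vinv q *: bar x + bar y.
Proof. by case: barP. Qed.

Lemma bar0 : bar 0 = 0.
Proof.
have := bar_lin 1 0 0; rewrite scale1r addr0 rmorph1 scale1r.
by rewrite -{1}[bar 0]addr0 => /addrI.
Qed.

Lemma barD x y : bar (x + y) = bar x + bar y.
Proof. by rewrite -[x]scale1r bar_lin rmorph1 !scale1r. Qed.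

Lemma barZ q x : bar (q *: x) = subst_vinv q *: bar x.
Proof. by rewrite -[_ *: x]addr0 bar_lin bar0 addr0. Qed.

Lemma barB x y : bar (x - y) = bar x - bar y.
Proof.
have e := barD (- y) y; rewrite addNr bar0 in e.
by rewrite barD; congr (_ + _); apply/eqP; rewrite -addr_eq0; apply/eqP.
Qed.

Lemma bar_sum I (r : seq I) (f : I -> fock) :
  bar (\sum_(i <- r) f i) = \sum_(i <- r) bar (f i).
Proof. exact: (big_morph bar barD bar0). Qed.

Lemma bar_wproj w x : bar (wproj w x) = wproj w (bar x).
Proof.
have [_ bar_s bar_F bar_D] := barP.
pose W x := forall w, bar (wproj w x) = wproj w (bar x).
suff : W x by apply.
apply: (fock_generated (W := W) n_gt1) => [a {}x y hx hy {}w|{}w|i {}x i_lt h {}w|k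
  {}x k_gt0 h {}w].
- rewrite (wprojP w a x y).
  have key X Y BX BY : bar X = BX -> bar Y = BY ->
      bar (a *: X + Y) = subst_vinv a *: BX + BY by move=> <- <-; exact: bar_lin.
  rewrite (key _ _ _ _ (hx w) (hy w)) (bar_lin a x y).
  exact: (esym (wprojP w (subst_vinv a) (bar x) (bar y))).
- rewrite bar_s wproj_s; case: ifP => _; [exact: bar_s|exact: bar0].
- exact: (commute_through (wproj_F w i) (fun y => bar_F i y i_lt) (h _)).
- exact: (commute_through (wproj_D w k) (fun y => bar_D k y k_gt0) (h _)).
Qed.

End WeightSpaces.

(** * Rigidity of two integral bases related by an involution *)

Section Rigidity.
Variables (F : fieldType) (ev ev' : {rmorphism {poly int} -> F}).
Hypothesis ev_const : forall p q, ev p = ev' q -> (size p <= 1)%N.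

(** If [ev p] is 0, so is [ev ('X * p)], which equals [ev' 0]; then ['X * p] is constant and p
    vanishes. *)
Let ev_inj : injective ev.
Proof.
have h p : ev p = 0 -> p = 0.
  move=> p0; have := @ev_const ('X * p) 0;
    rewrite rmorphM p0 mulr0 rmorph0 => /(_ erefl).
  have [//|pn0] := eqVneq p 0; rewrite mulrC size_mulX //.
  by rewrite ltnS leqn0 size_poly_eq0 (negPf pn0).
by move=> p q e; apply/eqP; rewrite -subr_eq0; apply/eqP/h; rewrite rmorphB e subrr.
Qed.

Variables (N : nat) (A : 'M[F]_N) (P Q : 'M[{poly int}]_N).
Hypothesis P0 : map_mx (horner_eval (0 : int)) P = 1%:M.
Hypothesis Q0 : map_mx (horner_eval (0 : int)) Q = 1%:M.
Hypothesis PA : map_mx ev P = map_mx ev' P *m A.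
Hypothesis QA : map_mx ev' Q = map_mx ev Q *m A.

(* The determinants p of P and q of Q satisfy ev (p q) = ev' (p q), so p q is
   constant: both matrices are unimodular over the polynomials. *)
Lemma det_rigid : \det P = 1.
Proof.
set p := \det P; set q := \det Q.
have p0 : p.[0] = 1 by rewrite -[LHS]/(horner_eval 0 p) -det_map_mx P0 det1.
have q0 : q.[0] = 1 by rewrite -[LHS]/(horner_eval 0 q) -det_map_mx Q0 det1.
have pA : ev p = ev' p * \det A by rewrite -det_map_mx PA det_mulmx det_map_mx.
have qA : ev' q = ev q * \det A by rewrite -det_map_mx QA det_mulmx det_map_mx.
have A0 : \det A != 0.
  apply/eqP => dA; have : p = 0 by apply: ev_inj; rewrite pA dA mulr0 rmorph0.
  by move=> pz; move: p0; rewrite pz horner0.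
have : ev (p * q) = ev' (p * q).
  by apply: (mulIf A0); rewrite !rmorphM -mulrA -qA mulrAC -pA mulrC.
move=> /ev_const s1; have s1' := size1_polyC s1.
have pq1 : p * q = 1.
  rewrite s1' -[_`_0]horner_coef0 hornerM p0 q0 mulr1 //.
have : p \is a GRing.unit by apply/unitrP; exists q; rewrite mulrC pq1.
by rewrite poly_unitE => /andP[/eqP sp _];
  rewrite (size1_polyC (eq_leq sp)) -horner_coef0 p0.
Qed.

Lemma invariant_row_eq0 (X : 'rV[{poly int}]_N) :
  map_mx ev ('X *: X) = map_mx ev' ('X *: X) *m A -> X = 0.
Proof.
(* The adjugate inverts P over the integral polynomials, since its determinant is 1. *)
move=> XA; have [Y XE] : exists Y, X = Y *m P.
  by exists (X *m \adj P); rewrite -mulmxA mul_adj_mx det_rigid mulmx1.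
have PU : map_mx ev P \in unitmx by rewrite unitmxE det_map_mx det_rigid rmorph1 unitr1.
have YE : map_mx ev ('X *: Y) = map_mx ev' ('X *: Y).
  apply: (can_inj (mulmxK PU)); rewrite -map_mxM -scalemxAl -XE XA PA mulmxA -map_mxM.
  by rewrite -scalemxAl -XE.
suff Y0 : Y = 0 by rewrite XE Y0 mul0mx.
apply/rowP => j; have := congr1 (fun M : 'rV_N => M 0 j) YE; rewrite !mxE => /ev_const.
have [-> //|y0] := eqVneq (Y 0 j) 0.
rewrite mulrC size_mulX //.
by rewrite ltnS leqn0 size_poly_eq0 (negPf y0).
Qed.

End Rigidity.

Lemma sum_delta (A : pzRingType) (I : finType) (f : I -> A) j :
  f j = \sum_k f k * (k == j)%:R.
Proof.
rewrite (bigD1 j) //= eqxx mulr1 big1 ?addr0 // => k /negPf ->.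
exact: mulr0.
Qed.

Section Uniqueness.
Variables (R : realType) (n : nat).
Hypothesis n_gt1 : (1 < n)%N.
Local Notation K := {fraction {poly R[i]}}.
Local Notation fock := (fock R).
Local Notation v := (v R).
Local Notation s := (fock_s R).

Lemma iev_const (t : K) : t = v \/ t = v^-1 ->
  forall p q, iev t p = iev t^-1 q -> (size p <= 1)%N.
Proof.
case=> -> p q; first exact: iev_v_vinv_const.
rewrite invrK => /(congr1 (@subst_vinv R)); rewrite !subst_iev subst_vinvV subst_vinv_v.
exact: iev_v_vinv_const.
Qed.

Lemma subst_vinv_t (t : K) : t = v \/ t = v^-1 -> subst_vinv t = t^-1.
Proof. by case=> ->; rewrite ?subst_vinvV ?invrK ?subst_vinv_v. Qed.

Variable bar : fock -> fock.
Hypothesis barP : is_bar n bar.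

Section WeightSpace.
Variable w : {ffun 'I_n -> int}.
Variable r : seq intpart.
Hypothesis r_uniq : uniq r.
Hypothesis r_mem : forall l, (l \in r) = (content n l == w).
Let e (j : 'I_(size r)) : intpart := nth empty_part r j.

Let e_w j : content n (e j) = w.
Proof. by apply/eqP; rewrite -r_mem mem_nth. Qed.

Let e_inj : injective e.
Proof. by move=> j k /eqP; rewrite nth_uniq // => /eqP/val_inj. Qed.

Definition coord (x : fock) : 'rV[K]_(size r) := \row_j x@_(e j).

Definition bar_mx : 'M[K]_(size r) := \matrix_(j, k) (bar (s (e j)))@_(e k).

Lemma wproj_sum_coord (x : fock) : wproj w x = \sum_j coord x 0 j *: s (e j).
Proof.
apply/malgP => m; rewrite wprojE raddf_sum /=.
case: eqP => [mw|mw]; last first.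
  rewrite big1 // => j _; rewrite mcoeffZ fock_sE.
  by case: eqP => [em|_]; [case: mw; rewrite -em | rewrite mulr0].
have mr : m \in r by rewrite r_mem mw.
have jP : (index m r < size r)%N by rewrite index_mem.
have -> : m = e (Ordinal jP) by rewrite /e nth_index.
move: (Ordinal jP) => j; apply: etrans (sum_delta (fun k => x@_(e k)) j) _.
apply: eq_bigr => k _; rewrite mcoeffZ fock_sE (inj_eq e_inj); congr (_ * _).
exact: esym (mxE _ _ _ _).
Qed.

Lemma coord_bar x : bar x = x -> coord x = map_mx (@subst_vinv R) (coord x) *m bar_mx.
Proof.
move=> bx; apply/rowP => k; rewrite !mxE.
have -> : x@_(e k) = (wproj w x)@_(e k) by rewrite wprojE e_w eqxx.
rewrite -{1}bx -(bar_wproj n_gt1 barP) wproj_sum_coord (bar_sum barP) raddf_sum.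
by apply: eq_bigr => j _; rewrite /= (barZ barP) mcoeffZ !mxE.
Qed.

(** Homogeneity of [G] is not yet known; [coord] keeps the component in the weight space, to which
    [coord_bar] applies. *)
Lemma canonical_matrix (t : K) (G : intpart -> fock) : is_canonical_basis bar t G ->
  exists2 P : 'M[{poly int}]_(size r), map_mx (horner_eval (0 : int)) P = 1%:M &
    forall j, coord (G (e j)) = row j (map_mx (iev t) P).
Proof.
move=> GP.
have [p pE] : exists p : 'I_(size r) -> 'I_(size r) -> {poly int},
    forall j k, (G (e j))@_(e k) = (j == k)%:R + t * iev t (p j k).
  have entry j k : exists q, (G (e j))@_(e k) = (j == k)%:R + t * iev t q.
    have [_ [y yL yE]] := GP (e j); have [q qE] := yL (e k); exists q.
    have := congr1 (fun x : fock => x@_(e k)) yE.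
    rewrite mcoeffB mcoeffZ fock_sE (inj_eq e_inj) qE => /eqP.
    by rewrite subr_eq addrC => /eqP.
  have rows j := fin_all_exists (entry j).
  exact: fin_all_exists rows.
exists (\matrix_(j, k) ((j == k)%:R + 'X * p j k)).
  apply/matrixP => j k;
    rewrite !mxE /horner_eval hornerD hornerMn hornerC hornerM hornerX mul0r.
  by rewrite addr0.
by move=> j; apply/rowP => k; rewrite !mxE pE rmorphD rmorphM rmorph_nat iev_X.
Qed.

Lemma coord_eq0 (t : K) G G' x y : t = v \/ t = v^-1 ->
  is_canonical_basis bar t G -> is_canonical_basis bar t^-1 G' ->
  bar x = x -> lattice t y -> x = t *: y -> coord x = 0.
Proof.
move=> tv GP G'P bx yL xE.
have bt : subst_vinv t = t^-1 := subst_vinv_t tv.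
have [P P0 PE] := canonical_matrix GP; have [Q Q0 QE] := canonical_matrix G'P.
have matE (u : K) (H : intpart -> fock) (M : 'M[{poly int}]_(size r)) :
    is_canonical_basis bar u H -> (forall j, coord (H (e j)) = row j (map_mx (iev u)
      M)) ->
    map_mx (iev u) M = map_mx (iev (subst_vinv u)) M *m bar_mx.
  move=> HP HM; apply/row_matrixP => j; rewrite -HM row_mul.
  have [bH _] := HP (e j); rewrite {1}(coord_bar bH) HM; congr (_ *m _).
  by apply/rowP => k; rewrite !mxE subst_iev.
have PA := matE _ _ _ GP PE; rewrite bt in PA.
have QA := matE _ _ _ G'P QE; rewrite fmorphV /= bt invrK in QA.
have [q qE] : exists q : 'I_(size r) -> {poly int}, forall k, y@_(e k) = iev t (q k).
  have entry k : exists q, y@_(e k) = iev t q := yL (e k).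
  exact: fin_all_exists entry.
pose X : 'rV[{poly int}]_(size r) := \row_k q k.
have XE : coord x = map_mx (iev t) ('X *: X).
  by apply/rowP => k; rewrite !mxE xE mcoeffZ qE rmorphM iev_X.
have X0 : X = 0.
  apply: (invariant_row_eq0 (iev_const tv) P0 Q0 PA QA).
  rewrite -XE {1}(coord_bar bx) XE; congr (_ *m _).
  by apply/rowP => k; rewrite !mxE subst_iev bt.
by rewrite XE X0 scaler0 map_mx0.
Qed.

End WeightSpace.

Lemma bar_invariant_eq0 (t : K) G G' x y : t = v \/ t = v^-1 ->
  is_canonical_basis bar t G -> is_canonical_basis bar t^-1 G' ->
  bar x = x -> lattice t y -> x = t *: y -> x = 0.
Proof.
move=> tv GP G'P bx yL xE; apply/malgP => m; rewrite mcoeff0.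
(* The residue content determines the size, so this list is the whole basis of the weight space. *)
pose r := [seq l <- parts (psize m) | content n l == content n m].
have r_mem l : (l \in r) = (content n l == content n m).
  by rewrite mem_filter mem_parts; case: eqP => //= /(content_psize n_gt1) ->;
    rewrite eqxx.
have r_uniq : uniq r by rewrite filter_uniq // parts_uniq.
have mr : (index m r < size r)%N by rewrite index_mem r_mem.
have := coord_eq0 r_uniq r_mem tv GP G'P bx yL xE.
move/(congr1 (fun M : 'rV_(size r) => M 0 (Ordinal mr))); rewrite !mxE /=.
by rewrite nth_index // r_mem.
Qed.

(** The component of [G l] in a weight space not containing s(l) is bar invariant and lies in t
    times the lattice. *)
Lemma canonical_homogeneous (t : K) G G' l m : t = v \/ t = v^-1 ->
  is_canonical_basis bar t G -> is_canonical_basis bar t^-1 G' ->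
  content n m != content n l -> (G l)@_m = 0.
Proof.
move=> tv GP G'P ml; have [bG [y yL yE]] := GP l.
have : wproj (content n m) (G l) = 0.
  apply: (bar_invariant_eq0 (y := wproj (content n m) y) tv GP G'P).
  - by rewrite (bar_wproj n_gt1 barP) bG.
  - move=> k; rewrite wprojE; case: ifP => _; first exact: yL.
    by exists 0; rewrite /int_eval rmorph0 horner0.
  - have -> : G l = t *: y + s l by rewrite -yE subrK.
    have z : wproj (content n m) (s l) = 0 by rewrite wproj_s eq_sym (negPf ml).
    by apply: etrans (wprojP _ _ _ _) _; rewrite z; exact: addr0.
by move/(congr1 (fun x : fock => x@_m)); rewrite wprojE eqxx mcoeff0.
Qed.

End Uniqueness.

(** * Comparison of canonical basis vectors across the bijection *)

Section Main.
Variables (R : realType) (n : nat).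
Hypothesis n_gt1 : (1 < n)%N.
Local Notation K := {fraction {poly R[i]}}.
Local Notation fock := (fock R).
Local Notation v := (v R).
Local Notation s := (fock_s R).

Lemma fock_F_iter_coef i k (x : fock) l : (iter k (fock_F n i) x)@_l
  = \sum_(m <- msupp x) x@_m * (iter k (fock_F n i) (s m))@_l.
Proof.
have [f fE] : exists f : {linear fock -> fock}, forall y, iter k (fock_F n i) y = f y.
  elim: k => [|k [f fE]]; first by exists idfun.
  by exists (fock_F n i \o f) => y; rewrite iterS fE.
rewrite fE {1}[x]fock_sum !raddf_sum; apply: eq_bigr => m _ /=.
by rewrite linearZ_LR mcoeffZ -fE.
Qed.

Variable bar : fock -> fock.
Hypothesis barP : is_bar n bar.
Variables (t : K) (G G' : intpart -> fock).
Hypothesis tv : t = v \/ t = v^-1.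
Hypothesis GP : is_canonical_basis bar t G.
Hypothesis G'P : is_canonical_basis bar t^-1 G'.

Variables (tau : intpart) (i w : nat).
Hypothesis tau_core : is_core n tau.
Hypothesis i_lt_n : (i < n)%N.
Hypothesis w_le : w%:Z <= scopes_k n tau i.

Local Notation spi := (scopes_pi n i).

Lemma canonical_scopes l m : P0 n tau w l -> P0 n tau w m ->
  (G m)@_l = (G (spi m))@_(spi l).
Proof.
move=> lP mP; have [m0 mk] := P0_signature n_gt1 i_lt_n tau_core w_le mP.
have [l0 _] := P0_signature n_gt1 i_lt_n tau_core w_le lP.
pose k := nrem n i m; set x := G (spi m).
have [bx [y yL yE]] := GP (spi m); rewrite -/x in bx yE.
have [bm [z zL zE]] := GP m.
have supp nu : x@_nu != 0 -> (forall a, ~~ removable_i n i nu a) /\ nadd n i nu = k.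
  move=> xnu; have /contentP-/(_ n_gt1) c : content n nu = content n (spi m).
    apply: contra_neq_eq xnu => c.
    exact: (canonical_homogeneous n_gt1 barP tv GP G'P c).
  have [r0 ak] := pi_block_signature n_gt1 i_lt_n tau_core w_le mP c.
  by split; [exact: nrem_eq0 | move: ak; rewrite -mk => -[]].
(* The partitions that can occur in the k-th iterate of F_i on x; all other coefficients vanish. *)
pose d l' := add_all n i (spi l') == l'.
have iterE l' : (iter k (fock_F n i) x)@_l' = qfact R k * ((d l')%:R * x@_(spi l')).
  rewrite fock_F_iter_coef (fock_coef x (spi l')) !mulr_sumr.
  apply: eq_bigr => nu _; have [->|/supp[nr na]] := eqVneq x@_nu 0.
    by rewrite !mul0r !mulr0.
  rewrite (@fock_F_iter R n i n_gt1 nu (size nu).+1 k _ na); last first.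
    by move=> a /addable_i_size.
  have -> : inversions n i nu (size nu).+1 = 0%N.
    rewrite /inversions big1 // => a _; rewrite /above big1 // => b _.
    by rewrite (negPf (nr b)).
  rewrite oppr0 expr0z mulr1 mcoeffZ fock_sE.
  have -> : (add_all n i nu == l') = d l' && (nu == spi l').
    apply/eqP/andP => [<-|[/eqP dl /eqP ->] //].
    by rewrite /d (pi_add_all n_gt1 nr) !eqxx.
  by rewrite -mulnb natrM; ring.
have q0 := qfact_neq0 R k.
pose H := (qfact R k)^-1 *: iter k (fock_F n i) x.
have HE l' : H@_l' = (d l')%:R * x@_(spi l').
  by rewrite /H mcoeffZ iterE mulrA mulVf // mul1r.
have bH : bar H = H.
  rewrite /H (barZ barP) fmorphV /= qfact_bar; congr (_ *: _).
  elim: (k) => [|j IH] //=; have [_ _ bF _] := barP.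
  by rewrite (bF _ _ i_lt_n) IH.
clearbody H.
have dm : d m by apply/eqP/add_all_pi => //; exact: nadd_eq0.
have dl : d l by apply/eqP/add_all_pi => //; exact: nadd_eq0.
have t0 : t != 0 by have := v_neq0 R; case: tv => ->; rewrite ?invr_eq0.
(* The leading term s(spi m) of x contributes precisely s(m) to H. *)
have delta l' : (d l')%:R * (spi m == spi l')%:R = (m == l')%:R :> K.
  rewrite -natrM mulnb; congr (_%:R); congr nat_of_bool.
  apply/andP/eqP => [[/eqP dl' /eqP e]|<-]; last by split; [exact: dm|exact: eqxx].
  exact: etrans (esym (eqP dm)) (etrans (congr1 (add_all n i) e) dl').
have key l' : (H - G m)@_l' = t * ((d l')%:R * y@_(spi l') - z@_l').
  have ex := congr1 (fun x : fock => x@_(spi l')) yE.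
  have ez := congr1 (fun x : fock => x@_l') zE.
  rewrite /= !mcoeffB !mcoeffZ !fock_sE in ex ez.
  by rewrite mcoeffB HE mulrBr -ez mulrCA -ex mulrBr delta; ring.
have H_eq : H = G m.
  apply/eqP; rewrite -subr_eq0; apply/eqP.
  apply: (bar_invariant_eq0 n_gt1 barP (y := t^-1 *: (H - G m)) tv GP G'P).
  - by apply: etrans (barB barP H (G m)) _; rewrite bH bm.
  - move=> l'; rewrite mcoeffZ key mulKf //.
    have [p pE] := yL (spi l'); have [q qE] := zL l'.
    exists ((d l')%:R * p - q); rewrite pE qE !int_evalE rmorphB rmorphM.
    by rewrite rmorph_nat.
  - exact: esym (scalerKV t0 (H - G m)).
by rewrite -H_eq HE dl mul1r.
Qed.

End Main.

Theorem theorem20 (R : realType) (n : nat) (hn : (2 <= n)%N)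
    (bar : fock R -> fock R) (hbar : is_bar n bar)
    (G Gm : intpart -> fock R)
    (hG : is_canonical_basis bar (v R) G)
    (hGm : is_canonical_basis bar (v R)^-1%R Gm)
    (d e : intpart -> intpart -> {poly int})
    (hd : is_d G d) (he : is_e Gm e)
    (tau : intpart) (htau : is_core n tau)
    (i : nat) (hi : (i < n)%N)
    (w : nat) (hw : (w%:Z <= scopes_k n tau i)%R)
    (lambda mu : intpart) (hlambda : P0 n tau w lambda) (hmu : P0 n tau w mu) :
  d lambda mu = d (scopes_pi n i lambda) (scopes_pi n i mu) /\
  e lambda mu = e (scopes_pi n i lambda) (scopes_pi n i mu).
Proof.
(* For the e-polynomials t is 1/v, and the two bases exchange their roles. *)
have hG' : is_canonical_basis bar (v R)^-1^-1 G by rewrite invrK.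
split.
  apply: (@iev_v_inj R); rewrite -!int_evalE -!hd.
  exact: (canonical_scopes hn hbar (or_introl erefl) hG hGm htau hi hw).
apply: (@iev_oppvinv_inj R); rewrite -!int_evalE -!he.
exact: (canonical_scopes hn hbar (or_intror erefl) hGm hG' htau hi hw).
Qed.
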